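(* Let $\{f_n\}_{n\ge1}$ be trade-off functions with $f_n(0)=1$ for all $n$, so that $f_n=T(U,Q_n)$ with $Q_n\ll U$. On $([0,1]^\infty,\mathcal B_\infty,U^\infty)$ let $$L_n(k)(\underline x)=\log\left(\frac{dQ_n^{\otimes k}}{dU^{\otimes k}}\right)(\underline x)=\sum_{i=1}^k\log|f_n'(1-x_i)|,\qquad g_n(t)=L_n(\lfloor tn\rfloor),\quad t\ge0.$$ Assume there is a Lévy process $\{L(t):t\ge0\}$ with $\mathbb{E}[\exp(L(t))]=1$ for all $t\ge0$ such that, under $U^\infty$, the process $\{g_n(t):t\ge0\}$ converges in distribution to $\{L(t):t\ge0\}$ as $n\to\infty$. Let $\{N_n\}_{n\ge1}$ be (nonnegative) integer-valued random variables on a probability space $(\Omega',\mathcal F',\mathbb P')$, regarded together with $g_n$ on the product space $(\Omega'\times[0,1]^\infty,\mathcal F'\otimes\mathcal B_\infty,\mathbb P'\otimes U^\infty)$, so that $N_n$ is independent of $g_n$ for every $n$. Assume that, under $\mathbb P'$, $N_n/n$ converges in distribution to $\tau$, where $\tau$ is a $[0,\infty)$-valued random variable, taken independent of $L$. Then, under $\mathbb P'\otimes U^\infty$, $$g_n\left(\frac{N_n}{n}\right)=L_n(N_n)\overset{d}{\to}L(\tau),\qquad\text{and}\qquad \mathbb{E}[\exp L(\tau)]=1.$$ Moreover, $f_n^{\otimes N_n}\to f_\infty$ pointwise on $[0,1]$, where $f_\infty=T(P_\infty,Q_\infty)$, $P_\infty$ is the law of $L(\tau)$, and $dQ_\inf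ty(x)=e^x\,dP_\infty(x)$.
   Context: For probability measures $P,Q$ on a measurable space $(\mathcal W,\mathcal F)$, the trade-off function $T(P,Q):[0,1]\to[0,1]$ is $$T(P,Q)(\alpha)=\inf\{\mathbb{E}_Q[1-\varphi] : \varphi:(\mathcal W,\mathcal F)\to[0,1]\text{ measurable},\ \mathbb{E}_P[\varphi]\le\alpha\}.$$ A trade-off function is any function of this form. $U$ is the uniform probability measure on $([0,1],\mathcal B_{[0,1]})$ and $U^\infty$ is its countable product on $[0,1]^\infty$. For a trade-off function $f$ with $f(0)=1$, the canonical representation is $f=T(U,Q_f)$ with $Q_f$ the probability measure on $[0,1]$ having $Q_f([0,x])=f(1-x)$ for $x\in[0,1)$; it satisfies $Q_f\ll U$ with density $-f'(1-x)$. We write $Q_n=Q_{f_n}$. A Lévy process has $L(0)=0$, independent stationary increments and right-continuous paths with left limits; convergence in distribution of processes is weak convergence of the entire process, in the Skorokhod space $D[0,\infty)$. The symbol $f_n^{\otimes N_n}$ (also written $T(U^{\otimes N_n},Q_n^{\otimes N_n})$) denotes the trade-off function of the experiment with a random number $N_n$ of independent repetitions, where $(N_n,x_1,\dots,x_{N_n})$ is observed: under the null, $N_n$ has its law under $\mathbb P'$ and, given $N_n=k$, $(x_1,\dots,x_k)\sim U^{\otimes k}$; under the alternative, $N_n$ has the same law and, given $N_n=k$, $(x_1,\dots,x_k)\sim Q_n^{\otimes k}$. The log-likelihood ratio of this experiment is $L_n(N_n)$. *)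

(* Defs.v *)
From HB Require Import structures.
From mathcomp Require Import all_boot all_order all_algebra.
From mathcomp Require Import all_classical all_reals all_analysis.

Set Implicit Arguments.
Unset Strict Implicit.
Unset Printing Implicit Defensive.

Import Order.TTheory GRing.Theory Num.Theory.
Import numFieldTopology.Exports numFieldNormedType.Exports.

Local Open Scope classical_set_scope.
Local Open Scope ring_scope.

Section tradeoff.
Context {R : realType}.

Definition tradeoff d (W : measurableType d) (P Q : probability W R)
    (alpha : R) : R :=
  inf [set fine 'E_Q[fun w => 1 - phi w] | phi in [set phi : W -> R |
    [/\ measurable_fun setT phi, forall w, 0 <= phi w <= 1 &
        ('E_P[phi] <= alpha%:E)%E]]].

(* Functions on [0, 1] are represented by functions on R whose values outside
   [0, 1] are irrelevant. *)
Definition is_tradeoff (f : R -> R) : Prop :=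
  exists (d : measure_display) (W : measurableType d) (P Q : probability W R),
    forall alpha, 0 <= alpha <= 1 -> f alpha = tradeoff P Q alpha.

(* Probability measures on [0, 1] are represented by probability measures on R
   carried by [0, 1]. *)
Definition unif : probability (measurableTypeR R) R :=
  uniform_prob (@ltr01 R).

Definition canonical_rep (f : R -> R)
    (Q : probability (measurableTypeR R) R) : Prop :=
  Q `[0, 1]%classic = 1%E /\
  forall x, 0 <= x < 1 -> Q `[0, x]%classic = (f (1 - x))%:E.

End tradeoff.

Section product_probability.
Context d1 d2 (T1 : measurableType d1) (T2 : measurableType d2) (R : realType).
Variables (P : probability T1 R) (Q : probability T2 R).

Let prod := (P \x Q)%E.

HB.instance Definition _ := Measure.on prod.

Let prod_setT : prod setT = 1%E.
Proof.
rewrite -setXTT [LHS]product_measure1E//.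
by rewrite -[RHS]mule1; congr *%E; exact: probability_setT.
Qed.

HB.instance Definition _ := Measure_isProbability.Build _ _ _ prod prod_setT.

Definition product_probability : probability (T1 * T2)%type R := prod.

End product_probability.

Definition seq_space (T : Type) := nat -> T.

Section seq_space.
Context d (T : measurableType d).

Definition coordinate_sets : set (set (seq_space T)) :=
  [set A | exists (i : nat) (B : set T),
    measurable B /\ A = [set x | B (x i)]].

HB.instance Definition _ := Pointed.on (seq_space T).
HB.instance Definition _ := @isMeasurable.Build (sigma_display coordinate_sets)
  (seq_space T) <<s coordinate_sets >> (@sigma_algebra0 _ setT coordinate_sets)
  (@sigma_algebraC _ coordinate_sets)
  (@sigma_algebra_bigcup _ setT coordinate_sets).

(* The values on finite-dimensional rectangles determine the countable product
   measure. *)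
Definition is_countable_power (R : realType) (P : probability T R)
    (Pinf : probability (seq_space T) R) : Prop :=
  forall (k : nat) (B : 'I_k -> set T), (forall i, measurable (B i)) ->
    Pinf [set x : seq_space T | forall i : 'I_k, B i (x i)] = (\prod_(i < k) P (B i))%E.

End seq_space.

Section tuple_power.
Context d (T : measurableType d) (R : realType) (P : probability T R).

Let cons_tuple k (z : T * k.-tuple T) : k.+1.-tuple T :=
  [the k.+1.-tuple T of z.1 :: z.2].

Let measurable_cons_tuple k : measurable_fun setT (@cons_tuple k).
Proof. by apply: measurable_cons => //; exact: measurable_snd. Qed.

HB.instance Definition _ k :=
  isMeasurableFun.Build _ _ _ _ (@cons_tuple k) (@measurable_cons_tuple k).

Fixpoint power_prob (k : nat) : probability (k.-tuple T) R :=
  match k with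
  | 0 => dirac [tuple]
  | k'.+1 => distribution (product_probability P (power_prob k'))
               (@cons_tuple k')
  end.

End tuple_power.

Definition finite_sample (T : Type) := {k : nat & k.-tuple T}.

Section finite_sample.
Context d (T : measurableType d).

Definition finite_sample_display : measure_display -> measure_display.
Proof. exact. Qed.

Definition finite_sample_measurable : set (set (finite_sample T)) :=
  [set A | forall k, measurable [set x : k.-tuple T | A (existT _ k x)]].

Let finite_sample_measurable0 : finite_sample_measurable set0.
Proof. by move=> k; exact: measurable0. Qed.

Let finite_sample_measurableC A :
  finite_sample_measurable A -> finite_sample_measurable (~` A).
Proof. by move=> mA k; exact: measurableC (mA k). Qed.

Let finite_sample_measurable_bigcup (F : (set (finite_sample T))^nat) :
  (forall i, finite_sample_measurable (F i)) ->
  finite_sample_measurable (\bigcup_i F i).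
Proof.
move=> mF k.
exact: (@bigcup_measurable _ _ (fun i => [set x | F i (existT _ k x)]) setT
  (fun i _ => mF i k)).
Qed.

HB.instance Definition _ := Choice.on (finite_sample T).
HB.instance Definition _ := isPointed.Build (finite_sample T)
  (existT (fun k => k.-tuple T) 0 [tuple]).
HB.instance Definition _ := @isMeasurable.Build (finite_sample_display d)
  (finite_sample T) finite_sample_measurable finite_sample_measurable0
  finite_sample_measurableC finite_sample_measurable_bigcup.

End finite_sample.

Section random_power.
Context (R : realType) d (T : measurableType d).
Variables (nu : probability nat R) (P : probability T R).

(* The law of (N, x_1, ..., x_N) when N has law nu and, given N = k,
   (x_1, ..., x_k) has law P^{(x)k}. *)
Definition random_power (A : set (finite_sample T)) : \bar R :=
  (\sum_(0 <= k <oo) nu [set k] *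
     power_prob P k [set x | A (existT _ k x)])%E.

Let random_power0 : random_power set0 = 0%E.
Proof.
rewrite /random_power eseries0// => k _ _.
by rewrite (_ : [set x | _] = set0) ?measure0 ?mule0.
Qed.

Let random_power_ge0 A : (0 <= random_power A)%E.
Proof. by apply: nneseries_ge0 => k _ _; exact: mule_ge0. Qed.

Let random_power_sigma_additive : semi_sigma_additive random_power.
Proof.
move=> F mF tF mUF.
have -> : random_power (\bigcup_n F n) =
    (\sum_(0 <= i <oo) random_power (F i))%E.
  rewrite /random_power nneseries_interchange; last first.
    by move=> i k; exact: mule_ge0.
  apply: eq_eseriesr => k _.
  have /fineK <- : nu [set k] \is a fin_num by exact: fin_num_measure.
  rewrite nneseriesZl//; congr *%E.
  rewrite (_ : [set x | _] = \bigcup_i [set x | F i (existT _ k x)])//.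
  apply/esym/cvg_lim => //; apply: measure_semi_sigma_additive.
  - by move=> i; exact: mF.
  - apply/trivIsetP => i j _ _ ij; move/trivIsetP : tF => /(_ i j I I ij) Fij.
    apply/seteqP; split => // x [Fi Fj].
    by have : (F i `&` F j) (existT _ k x) by []; rewrite Fij.
  - by apply: bigcup_measurable => i _; exact: mF.
by apply: is_cvg_nneseries => i _ _; exact: random_power_ge0.
Qed.

HB.instance Definition _ := isMeasure.Build _ _ _ random_power
  random_power0 random_power_ge0 random_power_sigma_additive.

Let random_power_setT : random_power setT = 1%E.
Proof.
rewrite /random_power -[RHS](probability_setT nu).
rewrite (_ : [set: nat] = \bigcup_k [set k]); last first.
  by apply/seteqP; split => // k _; exists k.
rewrite measure_semi_bigcup//=; last first.
  by apply/trivIsetP => i j _ _ ij; apply/seteqP; split => // x [-> /= /eqP];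
    rewrite (negbTE ij).
apply: eq_eseriesr => k _; rewrite -[RHS]mule1; congr *%E.
exact: probability_setT.
Qed.

HB.instance Definition _ :=
  Measure_isProbability.Build _ _ _ random_power random_power_setT.

End random_power.

Section skorokhod.
Context (R : realType).

(* Only the restriction of x to [0, oo) is considered. *)
Definition cadlag (T : topologicalType) (x : R -> T) : Prop :=
  (forall t, 0 <= t -> x s @[s --> t^'+] --> x t) /\
  (forall t, 0 < t -> exists l : T, x s @[s --> t^'-] --> l).

Record skorokhod (T : topologicalType) := Skorokhod {
  path_of :> R -> T ;
  cadlag_path_of : cadlag path_of }.

HB.instance Definition _ T := gen_eqMixin (skorokhod T).
HB.instance Definition _ T := gen_choiceMixin (skorokhod T).

Definition time_change (lambda : R -> R) : Prop :=
  [/\ set_bij [set t | 0 <= t] [set t | 0 <= t] lambda &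
      forall s t, 0 <= s -> s < t -> lambda s < lambda t].

(* These neighbourhoods generate the J1 topology: y_n is eventually in each
   skorokhod_ball x m e iff for every m there are time changes lambda_n with
   sup_{t <= m} |lambda_n t - t| -> 0 and
   sup_{t <= m} d(y_n (lambda_n t), x t) -> 0. *)
Definition skorokhod_ball (T : pseudoMetricType R) (x : skorokhod T) (m e : R)
  : set (skorokhod T) :=
  [set y | exists lambda, time_change lambda /\
    forall t, 0 <= t <= m ->
      `|lambda t - t| < e /\ ball (x t) e (y (lambda t))].

Definition skorokhod_open (T : pseudoMetricType R) (O : set (skorokhod T)) :=
  forall x, O x -> exists m e, 0 < e /\ skorokhod_ball x m e `<=` O.

Section skorokhod_topology.
Context (T : pseudoMetricType R).

Let skorokhod_openT : skorokhod_open [set: skorokhod T].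
Proof. by move=> x _; exists 0, 1. Qed.

Let skorokhod_openI : setI_closed (@skorokhod_open T).
Proof.
move=> A B oA oB x [/oA[m1 [e1 [e10 sA]]] /oB[m2 [e2 [e20 sB]]]].
exists (Num.max m1 m2), (Num.min e1 e2); split; first by rewrite lt_min e10.
move=> y [lambda [tc xy]]; split; [apply: sA|apply: sB]; exists lambda;
    split => // t /andP[t0 tm]; have [|lt_e xy_e] := xy t;
    rewrite ?t0 ?le_max ?tm ?orbT//; split;
    try by move: lt_e; rewrite lt_min => /andP[].
  by apply: le_ball xy_e; rewrite ge_min lexx.
by apply: le_ball xy_e; rewrite ge_min lexx orbT.
Qed.

Let skorokhod_open_bigU (I : Type) (f : I -> set (skorokhod T)) :
  (forall i, skorokhod_open (f i)) -> skorokhod_open (\bigcup_i f i).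
Proof.
move=> of_ x [i _ fix_]; have [m [e [e0 sf]]] := of_ i x fix_.
by exists m, e; split => // y /sf fiy; exists i.
Qed.

HB.instance Definition _ := isOpenTopological.Build (skorokhod T)
  skorokhod_openT skorokhod_openI skorokhod_open_bigU.

End skorokhod_topology.

Lemma cadlag_EFin (x : R -> R) : cadlag x -> cadlag (EFin \o x).
Proof.
move=> [rx lx]; split=> [t t0|t t0].
  by apply: cvg_EFin; [exact: nearW|exact: rx].
by have [l xl] := lx t t0; exists l%:E; apply: cvg_EFin; [exact: nearW|].
Qed.

Definition EFin_path (x : skorokhod R) : skorokhod (\bar R) :=
  Skorokhod (cadlag_EFin (cadlag_path_of x)).

Lemma cadlag_step (T : topologicalType) (u : nat -> T) (n : nat) :
  cadlag (fun t : R => u (Num.truncn (t * n%:R))).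
Proof.
case: n => [|n].
  have -> : (fun t : R => u (Num.truncn (t * 0%:R))) = cst (u 0%N).
    by apply/funext => t; rewrite mulr0 truncn0.
  by split=> [t _|t _]; [exact: cvg_cst|exists (u 0%N); exact: cvg_cst].
set c : R := n.+1%:R; have c0 : 0 < c by rewrite ltr0n.
split=> [t t0|t t0].
  apply: cvg_near_cst; near=> s; congr u.
  have ts : t < s by near: s; exact: nbhs_right_gt.
  apply: truncn_def; apply/andP; split.
    rewrite (@le_trans _ _ (t * c))// ?truncn_le ?mulr_ge0 ?(ltW c0)//.
    by rewrite ler_pM2r// ltW.
  rewrite -ltr_pdivlMr//; near: s; apply: nbhs_right_lt.
  by rewrite ltr_pdivlMr// truncnS_gt.
have tc0 : 0 < t * c by rewrite mulr_gt0.
pose k := (Num.truncn (t * c)%R - ((Num.truncn (t * c)%R)%:R == t * c)%R)%N.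
have [klt kge] : k%:R < t * c /\ t * c <= k.+1%:R.
  rewrite /k; have := truncn_le (t * c); rewrite (ltW tc0).
  rewrite le_eqVlt => /orP[/eqP E|lt_tc].
    rewrite E eqxx subn1; have : (0 < Num.truncn (t * c))%N.
      by rewrite -(@ltr_nat R) E.
    by case: (Num.truncn _) E => // m <- _ /=; rewrite ltr_nat ltnSn lexx.
  by rewrite (lt_eqF lt_tc) subn0; split => //; exact/ltW/truncnS_gt.
exists (u k); apply: cvg_near_cst; near=> s; congr u.
have st : s < t by near: s; exact: nbhs_left_lt.
apply: truncn_def; apply/andP; split.
  rewrite -ler_pdivrMr// ltW//; near: s; apply: nbhs_left_gt.
  by rewrite ltr_pdivrMr.
by rewrite (lt_le_trans _ kge)// ltr_pM2r.
Unshelve. all: by end_near. Qed.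

Definition step_path (T : topologicalType) (u : nat -> T) (n : nat) :
  skorokhod T := Skorokhod (cadlag_step u n).

End skorokhod.

Section processes.
Context (R : realType) d (Om : measurableType d) (P : probability Om R).

Definition is_law (X : Om -> R) (mu : probability (measurableTypeR R) R)
    : Prop :=
  measurable_fun setT X /\ forall A, measurable A -> mu A = P (X @^-1` A).

Record is_levy (L : Om -> skorokhod R R) : Prop := IsLevy {
  levy_measurable : forall t, 0 <= t -> measurable_fun setT (fun w => L w t) ;
  levy0 : forall w, L w 0 = 0 ;
  levy_indep : forall (k : nat) (t : nat -> R) (B : 'I_k -> set R),
    0 <= t 0%N -> nondecreasing_seq t -> (forall i, measurable (B i)) ->
    P [set w | forall i : 'I_k, B i (L w (t i.+1) - L w (t i))%R] =
    (\prod_(i < k) P [set w | B i (L w (t i.+1) - L w (t i))%R])%E ;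
  levy_stationary : forall (s h : R) (B : set R),
    0 <= s -> 0 <= h -> measurable B ->
    P [set w | B (L w (s + h) - L w s)%R] = P [set w | B (L w h - L w 0)%R] }.

Definition process_events (L : Om -> skorokhod R R) : set (set Om) :=
  <<s [set A | exists (t : R) (B : set R),
        [/\ 0 <= t, measurable B & A = [set w | B (L w t)]]] >>.

Definition indep_process (L : Om -> skorokhod R R) (tau : Om -> R) : Prop :=
  forall (A : set Om) (B : set R), process_events L A -> measurable B ->
    P (A `&` tau @^-1` B) = (P A * P (tau @^-1` B))%E.

End processes.

Definition cvg_in_law (R : realType) (E : topologicalType)
    d (Om : measurableType d) (P : probability Om R) (X_ : nat -> Om -> E)
    d' (Om' : measurableType d') (P' : probability Om' R) (X : Om' -> E) :=
  forall h : E -> R, continuous h -> (exists M, forall x, `|h x| <= M) ->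
    ('E_P[h \o X_ n] @[n --> \oo] --> 'E_P'[h \o X])%E.

Section log_likelihood.
Context {R : realType}.

(* sum_{i <= k} log |f'(1 - x_i)|, with log 0 = -oo; the indices of x start
   at 0. The derivative is two-sided, hence restricted to ]0, 1[. *)
Definition log_lr (f : R -> R) (k : nat)
    (x : seq_space (measurableTypeR R)) : \bar R :=
  (\sum_(i < k) lne `|(derive1 f \_ `]0, 1[%classic) (1 - x i)|%R%:E)%E.

(* The state space is \bar R since log_lr can be -oo; on real-valued paths the
   Skorokhod topologies of D([0, oo), R) and D([0, oo), \bar R) agree. *)
Definition log_lr_path (f : R -> R) (n : nat)
    (x : seq_space (measurableTypeR R)) : skorokhod R (\bar R) :=
  step_path R (fun k => log_lr f k x) n.

End log_likelihood.

(* Main.v *)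
Require Import Defs.
From HB Require Import structures.
From mathcomp Require Import all_boot all_order all_algebra.
From mathcomp Require Import all_classical all_reals all_analysis.
From mathcomp Require Import measurable_realfun.
From mathcomp Require Import ring lra.

Set Implicit Arguments.
Unset Strict Implicit.
Unset Printing Implicit Defensive.

Import Order.TTheory GRing.Theory Num.Theory.
Import numFieldTopology.Exports numFieldNormedType.Exports.

Local Open Scope classical_set_scope.
Local Open Scope ring_scope.

(**
A test of [P] against [Q] with [dQ = z dP] satisfies the duality
[tradeoff P Q alpha = sup_c (E_P[min(z, c)] - c * alpha)], where for [alpha > 0]
it suffices to let [c] range over [[0, 1/alpha]].  Hence trade-off functions
converge as soon as [E_P[min(z, c)]] converges for every [c]; as
[min(exp y, c)] is bounded and continuous on [\bar R], this follows from the
convergence in law of the log-likelihood ratios to a real variable [X] with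
[E[exp X] = 1].

For this convergence in law, evaluation at a fixed time is replaced by
[x |-> sup_s kappa(s) h(x(s))] with a bump function [kappa], which is continuous
for the Skorokhod topology.  Since a Levy process has no fixed jumps, letting
[kappa] shrink gives [E h(g_n(s)) -> E h(L(s))] uniformly for [s] in compact
sets, and one integrates [s] against the law of [N_n / n].
*)

(** * Densities and duality for trade-off functions *)

(** The bound [1/alpha] on the multiplier is Markov's inequality for [z], which has mean 1. It is
    void at [alpha = 0], where both trade-off functions equal 1 by absolute continuity. Two
    obstacles shape the rest. The likelihood ratio is built on [derive1 f], which takes a default
    value at the kinks of the convex function [f]. That it is a density of [Q] rests on left and
    right slopes having the same integrals, hence agreeing almost everywhere, and on [f 0 = 1],
    which makes [f] continuous at 0 and leaves no mass of [Q] at the endpoint 1. The second obstacle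
    is the random time: convergence at each fixed time does not survive averaging over [N_n / n], so
    bounds uniform in time are required. A supremum bounds the means only from above, which is why
    it is applied to both [M + h] and [M - h]. Uniformity holds on bounded time intervals, and a
    continuous cutoff transfers the tail of [tau] to that of [N_n / n]. In the limit, [tau] is
    approached from the right by grid times, at which independence reduces everything to
    deterministic times. *)

Section probability_integrals.
Context d (T : measurableType d) (R : realType) (P : probability T R).
Implicit Types f g : T -> R.

Lemma bounded_integrable f M : measurable_fun setT f ->
  (forall x, `|f x| <= M) -> P.-integrable setT (EFin \o f).
Proof.
move=> mf fM; apply: measurable_bounded_integrable => //.
  by rewrite -ge0_fin_numE//; exact: fin_num_measure.
exists M; split; first exact: num_real.
by move=> x Mx y _; exact: (le_trans (fM y) (ltW Mx)).
Qed.

Lemma integrable_scale (c : R) f : P.-integrable setT (EFin \o f) ->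
  P.-integrable setT (fun x => (c * f x)%:E).
Proof. by move=> fi; exact: (integrableZl measurableT c fi). Qed.

Lemma integrable_add f g : P.-integrable setT (EFin \o f) ->
  P.-integrable setT (EFin \o g) -> P.-integrable setT (fun x => (f x + g x)%:E).
Proof. by move=> fi gi; exact: (integrableD measurableT fi gi). Qed.

Lemma integrable_sub f g : P.-integrable setT (EFin \o f) ->
  P.-integrable setT (EFin \o g) -> P.-integrable setT (fun x => (f x - g x)%:E).
Proof. by move=> fi gi; exact: (integrableB measurableT fi gi). Qed.

Lemma integrable_cstT (c : R) : P.-integrable setT (fun=> c%:E).
Proof. exact: finite_measure_integrable_cst. Qed.

Lemma integral_EFin_Rintegral f : P.-integrable setT (EFin \o f) ->
  (\int[P]_x (f x)%:E)%E = (\int[P]_x f x)%:E.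
Proof. by move=> fi; rewrite /Rintegral fineK//; exact: integrable_fin_num. Qed.

Lemma Rintegral_cstT (r : R) : \int[P]_x r = r.
Proof.
rewrite Rintegral_cst// -[RHS]mulr1; congr (_ * _).
by transitivity (fine (1%E : \bar R)) => //; congr fine; exact: probability_setT.
Qed.

Lemma ae_eq_density (Q : probability T R) (z z' : T -> R) :
  measurable_fun setT z -> measurable_fun setT z' ->
  (forall x, 0 <= z x) -> (forall x, 0 <= z' x) ->
  (forall A, measurable A -> Q A = \int[P]_(x in A) (z x)%:E)%E ->
  (forall A, measurable A -> Q A = \int[P]_(x in A) (z' x)%:E)%E ->
  ae_eq P setT (EFin \o z) (EFin \o z').
Proof.
move=> mz mz' z0 z'0 Qz Qz'.
apply: integral_ae_eq => //.
- apply/integrableP; split; first exact/measurable_EFinP.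
  under eq_integral => x _ do rewrite gee0_abs ?lee_fin//.
  by rewrite -Qz// -ge0_fin_numE//; exact: fin_num_measure.
- exact/measurable_EFinP.
- by move=> A _ mA; rewrite /= -Qz// -Qz'.
Qed.

(** The change of variables is known for the Radon-Nikodym derivative; [z] agrees with it [P]-almost
    everywhere, so it may replace it under the integral. *)
Lemma ge0_integral_density (Q : probability T R) (z : T -> R)
    (h : T -> \bar R) :
  measurable_fun setT z -> (forall x, 0 <= z x) ->
  (forall A, measurable A -> Q A = \int[P]_(x in A) (z x)%:E)%E ->
  measurable_fun setT h -> (forall x, 0 <= h x)%E ->
  (\int[Q]_x h x = \int[P]_x (h x * (z x)%:E))%E.
Proof.
move=> mz z0 Qz mh h0.
pose f := Radon_Nikodym_SigmaFinite.f Q P.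
have QP : Q `<< P.
  apply/null_content_dominatesP => A mA A0.
  rewrite Qz// (@null_set_integral _ _ _ P)//.
  by apply/measurable_EFinP; exact: measurable_funS mz.
have f0 : forall x, (0 <= f x)%E by exact: Radon_Nikodym_SigmaFinite.f_ge0.
have ff := @Radon_Nikodym_SigmaFinite.f_fin_num _ _ _ Q P QP.
have mf : measurable_fun setT f.
  by apply: measurable_int; exact: Radon_Nikodym_SigmaFinite.f_integrable.
have fE : f = EFin \o (fine \o f) by apply/funext => x /=; rewrite fineK.
have mff : measurable_fun setT (fine \o f).
  by apply/measurable_EFinP; rewrite -fE.
have fz : ae_eq P setT f (EFin \o z).
  rewrite fE; apply: (@ae_eq_density Q) => //.
    by move=> x; rewrite fine_ge0.
  by move=> A mA; rewrite (Radon_Nikodym_SigmaFinite.f_integral QP)// -/f fE.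
rewrite -(Radon_Nikodym_SigmaFinite.change_of_variables QP)// -/f.
apply: ge0_ae_eq_integral => //.
- exact: emeasurable_funM.
- by apply: emeasurable_funM => //; exact/measurable_EFinP.
- by move=> x _; exact: mule_ge0.
- by move=> x _; rewrite mule_ge0// lee_fin.
- exact: ae_eqe_mul2l.
Qed.

End probability_integrals.

Section tradeoff_duality.
Context d (T : measurableType d) (R : realType) (P Q : probability T R).
Variable z : T -> R.
Hypotheses (mz : measurable_fun setT z) (z0 : forall x, 0 <= z x).
Hypothesis Qz : forall A, measurable A ->
  (Q A = \int[P]_(x in A) (z x)%:E)%E.

Let integral_z : (\int[P]_x (z x)%:E = 1)%E.
Proof. by rewrite -Qz//; exact: probability_setT. Qed.

Let integrable_z : P.-integrable setT (EFin \o z).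
Proof.
apply/integrableP; split; first exact/measurable_EFinP.
under eq_integral => x _ do rewrite gee0_abs ?lee_fin//.
by rewrite integral_z ltry.
Qed.

Let measurable_minz c : measurable_fun setT (fun x => Num.min (z x) c).
Proof. exact: measurable_minr. Qed.

Lemma integrable_min_density c : 0 <= c ->
  P.-integrable setT (fun x => (Num.min (z x) c)%:E).
Proof.
move=> c0; apply: (@bounded_integrable _ _ _ _ _ c) => // x.
by rewrite ger0_norm ?ge_min ?lexx ?orbT// le_min z0.
Qed.

Let test (phi : T -> R) (alpha : R) :=
  [/\ measurable_fun setT phi, forall w, 0 <= phi w <= 1 &
      ('E_P[phi] <= alpha%:E)%E].

Let integrable_test phi alpha : test phi alpha ->
  P.-integrable setT (EFin \o phi).
Proof.
case=> mphi phi01 _; apply: (@bounded_integrable _ _ _ _ _ 1) => // x.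
by have /andP[? ?] := phi01 x; rewrite ger0_norm.
Qed.

Let type2_error phi alpha : test phi alpha ->
  ('E_Q[fun w => (1 - phi w)%R] = \int[P]_x ((1 - phi x) * z x)%:E)%E.
Proof.
case=> mphi phi01 _; rewrite unlock (ge0_integral_density mz z0 Qz)//.
- by apply/measurable_EFinP; exact: measurable_funB.
- by move=> x; rewrite lee_fin subr_ge0; case/andP: (phi01 x).
Qed.

Let integrable_type2 phi alpha : test phi alpha ->
  P.-integrable setT (fun x => ((1 - phi x) * z x)%:E).
Proof.
case=> mphi phi01 _; apply: le_integrable integrable_z => //.
  apply/measurable_EFinP; apply: measurable_funM => //.
  exact: measurable_funB.
move=> x _; have /andP[p0 p1] := phi01 x; rewrite lee_fin.
by rewrite !ger0_norm// ?mulr_ge0 ?subr_ge0// ler_piMl// lerBlDl lerDr.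
Qed.

Let type2_errorR phi alpha : test phi alpha ->
  fine 'E_Q[fun w => 1 - phi w] = \int[P]_x ((1 - phi x) * z x).
Proof. by move=> t; rewrite (type2_error t). Qed.

Let tradeoff_has_inf alpha : 0 <= alpha ->
  has_inf [set fine 'E_Q[fun w => 1 - phi w] | phi in test^~ alpha].
Proof.
move=> a0; split.
  exists (fine 'E_Q[fun w => 1 - cst 0 w]), (cst 0) => //; split => //.
    by move=> w; rewrite lexx ler01.
  by rewrite expectation_cst lee_fin.
exists 0 => _ [phi t <-]; rewrite (type2_errorR t).
apply: Rintegral_ge0 => x _; case: t => _ /(_ x) /andP[_ ?] _.
by rewrite mulr_ge0// subr_ge0.
Qed.

(** Weak duality: [(1 - phi) * z + c * phi] is a convex combination of [z] and [c], hence at least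
    their minimum, and the level of [phi] is at most [alpha]. *)
Lemma tradeoff_ge_dual alpha c : 0 <= alpha -> 0 <= c ->
  \int[P]_x Num.min (z x) c - c * alpha <= tradeoff P Q alpha.
Proof.
move=> a0 c0; have [ne _] := tradeoff_has_inf a0.
apply: lb_le_inf => // _ [phi t <-]; rewrite (type2_errorR t).
have it := integrable_test t; have i2 := integrable_type2 t.
have [mphi phi01 Ephi] := t.
have {}Ephi : \int[P]_x phi x <= alpha.
  by move: Ephi; rewrite unlock integral_EFin_Rintegral// lee_fin.
rewrite lerBlDr (@le_trans _ _ (\int[P]_x ((1 - phi x) * z x) +
    c * \int[P]_x phi x))//; last by rewrite lerD2l ler_wpM2l.
rewrite -RintegralZl// -RintegralD//; last exact: integrable_scale.
apply: le_Rintegral => //.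
- exact: integrable_min_density.
- by apply: integrable_add => //; exact: integrable_scale.
move=> x _; have /andP[p0 p1] := phi01 x.
have [zc|cz] := leP (z x) c; first by have := z0 x; nra.
by have := z0 x; nra.
Qed.

(** A ramp from 0 at [z = c] to 1 at [z = c + e]. It replaces the Neyman-Pearson indicator, whose
    level jumps when [z] has atoms. *)
Let hinge e c x := Num.max 0 (Num.min 1 ((z x - c) / e)).

Let hinge01 e c x : 0 <= hinge e c x <= 1.
Proof. by rewrite /hinge le_max lexx/= ge_max ler01/= ge_min lexx. Qed.

Let measurable_hinge e c : measurable_fun setT (hinge e c).
Proof.
apply: measurable_maxr => //; apply: measurable_minr => //.
by apply: measurable_funM => //; exact: measurable_funB.
Qed.

Let integrable_hinge e c : P.-integrable setT (EFin \o hinge e c).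
Proof.
apply: (@bounded_integrable _ _ _ _ _ 1) => // x.
by have /andP[? ?] := hinge01 e c x; rewrite ger0_norm.
Qed.

Let hinge_lipschitz e c c' x : 0 < e ->
  `|hinge e c x - hinge e c' x| <= `|c - c'| / e.
Proof.
move=> e0; rewrite ler_pdivlMr//.
rewrite /hinge; set a := (z x - c) / e; set b := (z x - c') / e.
have -> : c - c' = (b - a) * e by rewrite /a /b; field; rewrite gt_eqF.
rewrite normrM (gtr0_norm e0) ler_wpM2r ?(ltW e0)//.
rewrite -[`|b - a|]distrC; move: (ler_norm (a - b)) (lerNnormlW (lexx `|a - b|)).
by case: (leP 1 a) => ?; case: (leP 1 b) => ?; rewrite ?(max_r ler01);
  case: (leP 0 a) => ?; case: (leP 0 b) => ? *; rewrite ler_norml; apply/andP;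
  split; lra.
Qed.

Let level_continuous e : 0 < e ->
  continuous (fun c => \int[P]_x hinge e c x).
Proof.
move=> e0 c; apply/cvgrPdist_le => r r0; near=> c'.
rewrite -RintegralB//; apply: le_trans (le_normr_Rintegral _ _) _ => //.
  exact: integrable_sub.
apply: (@le_trans _ _ (\int[P]_x r)); last by rewrite Rintegral_cstT.
apply: le_Rintegral => //.
- by apply: integrable_norm => //; exact: integrable_sub.
- by apply: integrable_cstT.
move=> x _; apply: le_trans (hinge_lipschitz _ _ _ e0) _.
rewrite ler_pdivrMr//; near: c'.
by apply: (@cvgr_dist_le _ _ _ _ _ id) => //; exact: mulr_gt0.
Unshelve. all: by end_near. Qed.

(* The test rejecting when [z > c], smoothed so that its level is continuous
   in [c], is almost optimal; its Lagrange multiplier is [c]. *)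
Lemma tradeoff_le_dual alpha e : 0 < alpha -> 0 < e -> exists c,
  0 <= c <= alpha^-1 /\
  tradeoff P Q alpha <= \int[P]_x Num.min (z x) c - c * alpha + e.
Proof.
move=> a0 e0; set m := fun c => \int[P]_x hinge e c x.
(* Pointwise [(1 - hinge) * z + c * hinge] exceeds [min(z, c)] by at most [e], the width of the
   ramp. *)
have bound c : 0 <= c -> m c <= alpha ->
    tradeoff P Q alpha <= \int[P]_x Num.min (z x) c - c * m c + e.
  move=> c0 mc; have t : test (hinge e c) alpha.
    by split => //; rewrite unlock integral_EFin_Rintegral// lee_fin.
  have -> : tradeoff P Q alpha =
    inf [set fine 'E_Q[fun w => 1 - phi w] | phi in test^~ alpha] by [].
  apply: (@le_trans _ _ (fine 'E_Q[fun w => 1 - hinge e c w])).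
    by apply: ge_inf; [case: (tradeoff_has_inf (ltW a0))|exists (hinge e c)].
  rewrite (type2_errorR t) addrAC lerBrDr.
  rewrite /m -RintegralZl// -RintegralD//; last 2 first.
  - exact: (integrable_type2 t).
  - exact: integrable_scale.
  rewrite -[X in _ <= _ + X](Rintegral_cstT P) -RintegralD//; last 2 first.
  - exact: integrable_min_density.
  - exact: integrable_cstT.
  apply: le_Rintegral => //.
  - by apply: integrable_add => //; [exact: (integrable_type2 t)|exact: integrable_scale].
  - apply: integrable_add => //; first exact: integrable_min_density.
    exact: integrable_cstT.
  move=> x _; have [zc|cz] := leP (z x) c.
    have -> : hinge e c x = 0.
      apply/max_idPl; rewrite ge_min; apply/orP; right.
      by rewrite pmulr_lle0 ?invr_gt0// subr_le0.
    by rewrite mulr0 addr0 subr0 mul1r lerDl ltW.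
  have := hinge01 e c x; move=> /andP[h0 h1].
  have [ze|ez] := leP (z x) (c + e); first by nra.
  have -> : hinge e c x = 1.
    rewrite /hinge; have -> : Num.min 1 ((z x - c) / e) = 1.
      by apply/min_idPl; rewrite ler_pdivlMr// mul1r lerBrDl ltW.
    by apply/max_idPr.
  by rewrite subrr mul0r add0r mulr1 lerDl ltW.
(* If the test at [c = 0] already has level at most [alpha], the constraint is not binding and the
   multiplier is 0. Otherwise some [c] attains the level [alpha] exactly. *)
have [m0|m0] := leP (m 0) alpha.
  exists 0; rewrite lexx invr_ge0 ltW//=; split => //.
  by have := bound 0 (lexx _) m0; rewrite !mul0r.
(* Markov's inequality: [hinge e alpha^-1 <= alpha * z] pointwise, and [z] has mean 1. *)
have mV : m alpha^-1 <= alpha.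
  have aV0 : 0 < alpha^-1 by rewrite invr_gt0.
  have az : \int[P]_x (alpha * z x) = alpha.
    rewrite RintegralZl// -[RHS]mulr1; congr (_ * _).
    by rewrite /Rintegral integral_z.
  rewrite -[leRHS]az.
  apply: le_Rintegral => //; first exact: (integrable_scale alpha integrable_z).
  move=> x _; change (hinge e alpha^-1 x <= alpha * z x).
  have [zc|cz] := leP (z x) (alpha^-1).
    have -> : hinge e alpha^-1 x = 0.
      apply/max_idPl; rewrite ge_min; apply/orP; right.
      by rewrite pmulr_lle0 ?invr_gt0// subr_le0.
    by rewrite mulr_ge0// ltW.
  have /andP[_ h1] := hinge01 e alpha^-1 x.
  by rewrite (le_trans h1)// mulrC -ler_pdivrMr// mul1r ltW.
have [c] : exists2 c, c \in `[0, alpha^-1] & m c = alpha.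
  apply: IVT.
  - by rewrite invr_ge0 ltW.
  - by apply: continuous_subspaceT; exact: level_continuous.
  - by rewrite minEle maxEle; case: ifPn; rewrite -?ltNge => ?; lra.
rewrite in_itv/= => /andP[c0 ca] mc.
exists c; rewrite c0 ca; split => //.
by have := bound c c0; rewrite mc; apply.
Qed.

(** A test of level 0 vanishes [P]-almost everywhere, hence has no effect on [(1 - phi) * z], whose
    integral stays 1. *)
Lemma tradeoff_level0 : tradeoff P Q 0 = 1.
Proof.
suff h phi : test phi 0 -> fine 'E_Q[fun w => 1 - phi w] = 1.
  change (inf [set fine 'E_Q[fun w => 1 - phi w] | phi in test^~ 0] = 1).
  rewrite (_ : [set fine 'E_Q[fun w => 1 - phi w] | phi in test^~ 0] = [set 1]).
    exact: inf1.
  apply/seteqP; split => [_ [phi t <-]|y ->]; first exact: h.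
  have [[_ [phi t _]] _] := tradeoff_has_inf (lexx 0).
  by exists phi => //; exact: h.
move=> t; rewrite (type2_errorR t).
have [mphi phi01] := t; rewrite unlock => Ephi.
have phiae : ae_eq P setT (EFin \o phi) (cst 0%E).
  apply/ae_eq_integral_abs => //; first exact/measurable_EFinP.
  apply/eqP; rewrite eq_le integral_ge0// andbT; apply: le_trans Ephi.
  rewrite le_eqVlt; apply/orP; left; apply/eqP; apply: eq_integral => x _.
  by rewrite gee0_abs// lee_fin; case/andP: (phi01 x).
rewrite /Rintegral; transitivity (fine (1%E : \bar R)) => //; congr fine.
rewrite -integral_z; apply: ae_eq_integral => //.
- exact: measurable_int (integrable_type2 t).
- exact/measurable_EFinP.
apply: filterS phiae => x /= + _ => /(_ I) [->].
by rewrite subr0 mul1r.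
Qed.

Lemma cvg_integral_min_density :
  \int[P]_x Num.min (z x) n%:R @[n --> \oo] --> (1 : R).
Proof.
apply: (@fine_cvg _ _ _ _ (fun n => \int[P]_x (Num.min (z x) n%:R)%:E)%E).
rewrite -integral_z; apply: (dominated_cvg measurableT _ _ _ integrable_z).
- by move=> n; apply/measurable_EFinP.
- move=> x _; apply: cvg_EFin; first exact: nearW.
  apply: cvg_near_cst; near=> n; apply/min_idPl.
  by near: n; exact: nbhs_infty_ger.
- by [].
- move=> n x _; rewrite lee_fin ger0_norm ?ge_min ?lexx// le_min z0 ler0n//.
Unshelve. all: by end_near. Qed.

End tradeoff_duality.

(** * Convergence of trade-off functions *)

Section tradeoff_convergence.
Context (R : realType).

Definition has_density d (T : measurableType d) (P Q : probability T R)
    (z : T -> R) : Prop :=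
  [/\ measurable_fun setT z, forall x, 0 <= z x &
      forall A, measurable A -> (Q A = \int[P]_(x in A) (z x)%:E)%E].

(** The equicontinuity in the multiplier that upgrades pointwise convergence to uniform convergence
    on [[0, 1/alpha]]. *)
Lemma integral_min_lipschitz d (T : measurableType d) (P Q : probability T R)
    (z : T -> R) (a b : R) : has_density P Q z -> 0 <= a -> 0 <= b ->
  `|\int[P]_x Num.min (z x) a - \int[P]_x Num.min (z x) b| <= `|a - b|.
Proof.
move=> [mz z0 Qz] a0 b0.
have ia := integrable_min_density P mz z0 a0.
have ib := integrable_min_density P mz z0 b0.
rewrite -RintegralB//; apply: le_trans (le_normr_Rintegral _ _) _ => //.
  exact: integrable_sub.
rewrite -[leRHS](Rintegral_cstT P); apply: le_Rintegral => //.
- by apply: integrable_norm => //; exact: integrable_sub.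
- exact: integrable_cstT.
move=> x _; move: (ler_norm (a - b)) (lerNnormlW (lexx `|a - b|)) => h1 h2.
have := normr_ge0 (a - b) => h3.
by case: (leP (z x) a) => ?; case: (leP (z x) b) => ?;
  rewrite ler_norml; apply/andP; split; lra.
Qed.

(** The dual objectives converge uniformly in [c] on the compact range of near-optimal multipliers,
    and hence so do their suprema. *)
Lemma cvg_tradeoff d (T : measurableType d) d' (T' : measurableType d')
    (P_ Q_ : nat -> probability T R) (z_ : nat -> T -> R)
    (P Q : probability T' R) (z : T' -> R) :
  (\forall n \near \oo, has_density (P_ n) (Q_ n) (z_ n)) ->
  has_density P Q z ->
  (forall c, 0 <= c ->
    \int[P_ n]_x Num.min (z_ n x) c @[n --> \oo] -->
    \int[P]_x Num.min (z x) c) ->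
  forall alpha, 0 <= alpha ->
    tradeoff (P_ n) (Q_ n) alpha @[n --> \oo] --> tradeoff P Q alpha.
Proof.
move=> dn dP cvgA alpha; rewrite le_eqVlt => /predU1P[<-|a0].
  case: (dP) => mz z0 Qz; rewrite (tradeoff_level0 mz z0 Qz).
  apply: cvg_near_cst; apply: filterS dn => n [mzn zn0 Qzn].
  exact: tradeoff_level0 mzn zn0 Qzn.
have unif e : 0 < e -> \forall n \near \oo, forall c, c \in `[0, alpha^-1] ->
    `|\int[P_ n]_x Num.min (z_ n x) c - \int[P]_x Num.min (z x) c| <= e.
  move=> e0.
  have /compact_near_coveringP cpt := @segment_compact R 0 alpha^-1.
  have := @cpt nat \oo (fun n c => c \in `[0, alpha^-1] ->
    `|\int[P_ n]_x Num.min (z_ n x) c - \int[P]_x Num.min (z x) c| <= e) _.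
  case=> [c|n _ nP]; last by exists n => // m /nP h c cI; exact: h.
  rewrite /= in_itv/= => /andP[c0 _]; near=> c' n => /=.
  rewrite in_itv/= => /andP[c'0 _].
  have dist : `|c' - c| <= e / 3.
    near: c'; apply: (@cvgr_distC_le _ _ _ _ _ id) => //.
    by rewrite divr_gt0.
  have An : `|\int[P_ n]_x Num.min (z_ n x) c - \int[P]_x Num.min (z x) c|
      <= e / 3.
    near: n; move/cvgrPdistC_le : (cvgA c c0); apply.
    by rewrite divr_gt0.
  have dn' : has_density (P_ n) (Q_ n) (z_ n) by near: n.
  move: (le_trans (integral_min_lipschitz dn' c'0 c0) dist).
  move: (le_trans (integral_min_lipschitz dP c'0 c0) dist) An.
  rewrite !ler_norml => /andP[? ?] /andP[? ?] /andP[? ?].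
  by apply/andP; split; lra.
apply/cvgrPdist_le => e e0.
have e20 : 0 < e / 2 by rewrite divr_gt0.
near=> n.
have [mz z0 Qz] := dP.
have [mzn zn0 Qzn] : has_density (P_ n) (Q_ n) (z_ n) by near: n.
have un : forall c, c \in `[0, alpha^-1] ->
    `|\int[P_ n]_x Num.min (z_ n x) c - \int[P]_x Num.min (z x) c| <= e / 2.
  by near: n; exact: unif.
(* Each side's near-optimal multiplier is fed into the weak duality of the other side. Half of [e]
   pays for near-optimality, half for the uniform distance. *)
have [c [/andP[c0 ca] le1]] := tradeoff_le_dual mz z0 Qz a0 e20.
have [c' [/andP[c'0 c'a] le2]] := tradeoff_le_dual mzn zn0 Qzn a0 e20.
have ge1 := tradeoff_ge_dual mz z0 Qz (ltW a0) c'0.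
have ge2 := tradeoff_ge_dual mzn zn0 Qzn (ltW a0) c0.
have := un c; rewrite in_itv/= c0 ca => /(_ isT); rewrite ler_norml => /andP[? ?].
have := un c'; rewrite in_itv/= c'0 c'a => /(_ isT); rewrite ler_norml => /andP[? ?].
by rewrite ler_norml; apply/andP; split; lra.
Unshelve. all: by end_near. Qed.

End tradeoff_convergence.

(** * Convexity and boundary values of trade-off functions *)

Section tradeoff_basics.
Context d (W : measurableType d) (R : realType) (P Q : probability W R).

Let test (phi : W -> R) (alpha : R) :=
  [/\ measurable_fun setT phi, forall w, 0 <= phi w <= 1 &
      ('E_P[phi] <= alpha%:E)%E].

Let errors alpha := [set fine 'E_Q[fun w => 1 - phi w] | phi in test^~ alpha].

Let integrable_test (P' : probability W R) phi alpha : test phi alpha ->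
  P'.-integrable setT (EFin \o phi).
Proof.
case=> mphi phi01 _; apply: (@bounded_integrable _ _ _ _ _ 1) => // x.
by have /andP[? ?] := phi01 x; rewrite ger0_norm.
Qed.

Let errorE phi alpha : test phi alpha ->
  fine 'E_Q[fun w => 1 - phi w] = 1 - \int[Q]_x phi x.
Proof.
move=> t; rewrite unlock -[fine _]/(\int[Q]_x (1 - phi x)).
rewrite RintegralB ?Rintegral_cstT//; first exact: integrable_cstT.
exact: (integrable_test Q t).
Qed.

Let level phi alpha : test phi alpha -> \int[P]_x phi x <= alpha.
Proof.
move=> t; have := integrable_test P t; case: t => _ _.
by rewrite unlock => + i; rewrite integral_EFin_Rintegral// lee_fin.
Qed.

Let testI (phi : W -> R) (alpha : R) : measurable_fun setT phi ->
  (forall w, 0 <= phi w <= 1) -> \int[P]_x phi x <= alpha -> test phi alpha.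
Proof.
move=> mphi phi01 le_alpha; split => //.
rewrite unlock integral_EFin_Rintegral// ?lee_fin//.
apply: (@bounded_integrable _ _ _ _ _ 1) => // x.
by have /andP[? ?] := phi01 x; rewrite ger0_norm.
Qed.

Let error_ge0 phi alpha : test phi alpha -> \int[Q]_x phi x <= 1.
Proof.
move=> t; rewrite -[leRHS](Rintegral_cstT Q); apply: le_Rintegral => //.
- exact: (integrable_test Q t).
- exact: integrable_cstT.
- by move=> x _; case: t => _ /(_ x) /andP[].
Qed.

Let errors_lbound alpha : has_lbound (errors alpha).
Proof.
exists 0 => _ [phi t <-]; rewrite (errorE t) subr_ge0.
exact: (error_ge0 t).
Qed.

Let errors_neq0 alpha : 0 <= alpha -> errors alpha !=set0.
Proof.
move=> a0; exists (fine 'E_Q[fun w => 1 - cst 0 w]), (cst 0) => //.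
apply: testI => //; first by move=> w; rewrite lexx ler01.
by rewrite Rintegral_cstT.
Qed.

Lemma tradeoff_le (phi : W -> R) alpha : measurable_fun setT phi ->
  (forall w, 0 <= phi w <= 1) -> \int[P]_x phi x <= alpha ->
  tradeoff P Q alpha <= 1 - \int[Q]_x phi x.
Proof.
move=> mphi phi01 le_alpha; have t := testI mphi phi01 le_alpha.
rewrite -(errorE t); apply: ge_inf; first exact: errors_lbound.
by exists phi.
Qed.

(** Levels and errors are affine in the test, so a mixture of near-optimal tests at [a] and [b]
    competes at the mixed level. *)
Lemma tradeoff_convex (a b t : R) : 0 <= a -> 0 <= b -> 0 <= t <= 1 ->
  tradeoff P Q (t * a + (1 - t) * b) <=
  t * tradeoff P Q a + (1 - t) * tradeoff P Q b.
Proof.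
move=> a0 b0 /andP[t0 t1]; apply/ler_addgt0Pr => e e0.
have [_ [phi tphi <-] phie] := @inf_adherent _ (errors a) e e0
  (conj (errors_neq0 a0) (errors_lbound a)).
have [_ [psi tpsi <-] psie] := @inf_adherent _ (errors b) e e0
  (conj (errors_neq0 b0) (errors_lbound b)).
move: phie psie; rewrite (errorE tphi) (errorE tpsi) => phie psie.
pose chi w := t * phi w + (1 - t) * psi w.
have [mphi phi01 _] := tphi; have [mpsi psi01 _] := tpsi.
have mchi : measurable_fun setT chi.
  by apply: measurable_funD; exact: measurable_funM.
have chi01 w : 0 <= chi w <= 1.
  have /andP[? ?] := phi01 w; have /andP[? ?] := psi01 w.
  by rewrite /chi; apply/andP; split; nra.
have Echi (P' : probability W R) : \int[P']_x chi x =
    t * \int[P']_x phi x + (1 - t) * \int[P']_x psi x.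
  have i1 := integrable_test P' tphi; have i2 := integrable_test P' tpsi.
  by rewrite RintegralD ?RintegralZl//; exact: integrable_scale.
have le1 := level tphi; have le2 := level tpsi.
have := @tradeoff_le chi (t * a + (1 - t) * b) mchi chi01.
rewrite !Echi => /(_ _)/le_trans; apply.
  by apply: lerD; apply: ler_wpM2l => //; rewrite subr_ge0.
have ea : 1 - \int[Q]_x phi x <= tradeoff P Q a + e by exact: ltW.
have eb : 1 - \int[Q]_x psi x <= tradeoff P Q b + e by exact: ltW.
have t1' : 0 <= 1 - t by rewrite subr_ge0.
have := ler_wpM2l t0 ea; have := ler_wpM2l t1' eb.
lra.
Qed.

Lemma tradeoff1 : tradeoff P Q 1 = 0.
Proof.
apply/eqP; rewrite eq_le; apply/andP; split.
  have := @tradeoff_le (cst 1) 1.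
  by rewrite !Rintegral_cstT subrr; apply => // w; rewrite ler01 lexx.
apply: lb_le_inf; first exact: errors_neq0.
by move=> _ [phi t <-]; rewrite (errorE t) subr_ge0; exact: (error_ge0 t).
Qed.

(** The indicator of a [P]-null set is a test of level 0; its error is 1 only if the set is also
    [Q]-null. *)
Lemma tradeoff0_dominates : tradeoff P Q 0 = 1 -> Q `<< P.
Proof.
move=> T0; apply/null_content_dominatesP => A mA PA0.
have IE (P' : probability W R) : \int[P']_x \1_A x = fine (P' A).
  by rewrite /Rintegral integral_indic// setIT.
have := @tradeoff_le \1_A 0; rewrite !IE PA0 T0/=.
have h : 1 <= 1 - fine (Q A) -> Q A = 0%E.
  move=> QA; have QA0 : fine (Q A) <= 0 by lra.
  rewrite -[LHS]fineK ?fin_num_measure//; congr EFin.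
  by apply/eqP; rewrite eq_le QA0 fine_ge0.
move=> H; apply: h; apply: H => //.
by move=> w; rewrite indicE; case: (_ \in _) => /=; rewrite ?lexx ler01.
Qed.

(** Continuity at level 0, read off the dual bound with a fixed multiplier [n] for which [min(z, n)]
    has integral at least [1 - e / 2]. Dividing by [n.+1] covers the case [n = 0]. *)
Lemma tradeoff_near0 (e : R) : tradeoff P Q 0 = 1 -> 0 < e ->
  exists2 r, 0 < r & forall alpha, 0 <= alpha <= r ->
    1 - e <= tradeoff P Q alpha.
Proof.
move=> /tradeoff0_dominates QP e0.
pose f := Radon_Nikodym_SigmaFinite.f Q P; pose z := fine \o f.
have f0 : forall x, (0 <= f x)%E by exact: Radon_Nikodym_SigmaFinite.f_ge0.
have fz : f = EFin \o z.
  by apply/funext => x /=; rewrite fineK//; exact: Radon_Nikodym_SigmaFinite.f_fin_num.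
have mz : measurable_fun setT z.
  apply/measurable_EFinP; rewrite -fz.
  by apply: measurable_int; exact: Radon_Nikodym_SigmaFinite.f_integrable.
have z0 x : 0 <= z x by rewrite fine_ge0.
have Qz A : measurable A -> (Q A = \int[P]_(x in A) (z x)%:E)%E.
  by move=> mA; rewrite (Radon_Nikodym_SigmaFinite.f_integral QP)// -/f fz.
have := cvg_integral_min_density mz z0 Qz.
have e20 : 0 < e / 2 by rewrite divr_gt0.
move=> /cvgrPdist_le /(_ _ e20)[n _ /(_ n (leqnn n))].
rewrite ler_norml => /andP[_ nP].
exists (e / 2 / n.+1%:R); first by rewrite divr_gt0.
move=> alpha /andP[a0]; rewrite ler_pdivlMr// => ale.
have := tradeoff_ge_dual mz z0 Qz a0 (ler0n R n).
have : n%:R * alpha <= alpha * n.+1%:R by rewrite mulrC ler_wpM2l// ler_nat.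
lra.
Qed.

End tradeoff_basics.

(** * Convex functions and the density of the canonical representation *)

Section one_sided_derivatives.
Context (R : realType) (F : R -> R).

Let I01 (u : R) := 0 < u < 1.
Let slope u v := (F v - F u) / (v - u).

Hypothesis cvxF : forall u v w : R, 0 < u -> u < v -> v < w -> w < 1 ->
  (w - u) * F v <= (w - v) * F u + (v - u) * F w.

(** The right derivative: chord slopes of a convex function are monotone, so the limit at [u] is an
    infimum and exists everywhere on []0, 1[]. *)
Definition right_slope u := inf [set slope u v | v in [set v | u < v < 1]].
Definition left_slope v := sup [set slope u v | u in [set u | 0 < u < v]].

Let slope_left (u v w : R) : 0 < u -> u < v -> v < w -> w < 1 ->
  slope u v <= slope u w.
Proof.
move=> u0 uv vw w1; have := cvxF u0 uv vw w1.
rewrite /slope ler_pdivrMr ?subr_gt0// mulrAC ler_pdivlMr; last by lra.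
by move=> ?; lra.
Qed.

Let slope_right (u v w : R) : 0 < u -> u < v -> v < w -> w < 1 ->
  slope u w <= slope v w.
Proof.
move=> u0 uv vw w1; have := cvxF u0 uv vw w1.
rewrite /slope ler_pdivrMr; last by lra.
rewrite mulrAC ler_pdivlMr ?subr_gt0//.
by move=> ?; lra.
Qed.

Let slope_mid (u v w : R) : 0 < u -> u < v -> v < w -> w < 1 ->
  slope u v <= slope v w.
Proof.
move=> u0 uv vw w1; have := cvxF u0 uv vw w1.
rewrite /slope ler_pdivrMr ?subr_gt0// mulrAC ler_pdivlMr ?subr_gt0//.
by move=> ?; lra.
Qed.

Let right_neq0 u : I01 u -> [set slope u v | v in [set v | u < v < 1]] !=set0.
Proof.
move=> /andP[u0 u1]; exists (slope u ((u + 1) / 2)), ((u + 1) / 2) => //=.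
by apply/andP; split; lra.
Qed.

Let left_neq0 u : I01 u -> [set slope v u | v in [set v | 0 < v < u]] !=set0.
Proof.
move=> /andP[u0 u1]; exists (slope (u / 2) u), (u / 2) => //=.
by apply/andP; split; lra.
Qed.

Let right_lbound u : I01 u ->
  has_lbound [set slope u v | v in [set v | u < v < 1]].
Proof.
move=> /andP[u0 u1]; exists (slope (u / 2) u) => _ [v /andP[uv v1] <-].
by apply: slope_mid => //; lra.
Qed.

Let left_ubound u : I01 u ->
  has_ubound [set slope v u | v in [set v | 0 < v < u]].
Proof.
move=> /andP[u0 u1]; exists (slope u ((u + 1) / 2)) => _ [v /andP[v0 vu] <-].
by apply: slope_mid => //; lra.
Qed.

Lemma right_slope_le u v : I01 u -> u < v -> v < 1 ->
  right_slope u <= slope u v.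
Proof.
move=> u01 uv v1; apply: ge_inf; first exact: right_lbound.
by exists v => //=; rewrite uv.
Qed.

Lemma left_slope_ge u v : I01 v -> 0 < u -> u < v ->
  slope u v <= left_slope v.
Proof.
move=> v01 u0 uv; apply: ub_le_sup; first exact: left_ubound.
by exists u => //=; rewrite u0.
Qed.

Lemma right_slope_ge u v : I01 v -> 0 < u -> u < v ->
  slope u v <= right_slope v.
Proof.
move=> v01 u0 uv; apply: lb_le_inf; first exact: right_neq0.
by move=> _ [w /andP[vw w1] <-]; exact: slope_mid.
Qed.

Lemma left_slope_le u v : I01 u -> u < v -> v < 1 ->
  left_slope u <= slope u v.
Proof.
move=> u01 uv v1; apply: ge_sup; first exact: left_neq0.
by move=> _ [w /andP[w0 wu] <-]; exact: slope_mid.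
Qed.

Lemma left_le_right_slope u : I01 u -> left_slope u <= right_slope u.
Proof.
move=> u01; apply: lb_le_inf; first exact: right_neq0.
by move=> _ [v /andP[uv v1] <-]; exact: left_slope_le.
Qed.

Lemma cvg_right_slope u : I01 u ->
  slope u v @[v --> u^'+] --> right_slope u.
Proof.
move=> u01; apply/cvgrPdist_lt => e e0.
have [_ [w /andP[uw w1] <-] we] := @inf_adherent _
  [set slope u v | v in [set v | u < v < 1]] e e0
  (conj (right_neq0 u01) (right_lbound u01)).
near=> v.
have uv : u < v by near: v; exact: nbhs_right_gt.
have vw : v < w by near: v; exact: nbhs_right_lt.
have /andP[u0 u1] := u01.
have := right_slope_le u01 uv (lt_trans vw w1).
have := slope_left u0 uv vw w1.
rewrite distrC ltr_norml => ? ?; apply/andP.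
have : slope u w < right_slope u + e by [].
by split; lra.
Unshelve. all: by end_near. Qed.

Lemma cvg_left_slope u : I01 u ->
  slope v u @[v --> u^'-] --> left_slope u.
Proof.
move=> u01; apply/cvgrPdist_lt => e e0.
have [_ [w /andP[w0 wu] <-] we] := @sup_adherent _
  [set slope v u | v in [set v | 0 < v < u]] e e0
  (conj (left_neq0 u01) (left_ubound u01)).
near=> v.
have vu : v < u by near: v; exact: nbhs_left_lt.
have wv : w < v by near: v; exact: nbhs_left_gt.
have /andP[u0 u1] := u01.
have := left_slope_ge u01 (lt_trans w0 wv) vu.
have := slope_right w0 wv vu u1.
rewrite ltr_norml => ? ?; apply/andP.
have : left_slope u - e < slope w u by [].
by split; lra.
Unshelve. all: by end_near. Qed.

(** At a kink the value is such that its opposite is the default [point]. *)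
Definition two_sided_slope u :=
  if left_slope u == right_slope u then right_slope u else - (point : R).

(* [derive1] returns the default value of [lim] where the one-sided
   derivatives differ. *)
Lemma derive1_reflect (f : R -> R) u : I01 u ->
  (forall x : R, 0 <= x <= 1 -> F x = f (1 - x)) ->
  derive1 f (1 - u) = - two_sided_slope u.
Proof.
move=> u01 Ff; have /andP[u0 u1] := u01.
rewrite /derive1; set G := (fun h : R => _).
have Fu : F u = f (1 - u) by rewrite Ff// !ltW.
(* Reflection exchanges the sides: an increment of [f] to the right of [1 - u] is a chord of [F] to
   the left of [u]. *)
have right_cvg : G @ 0^'+ --> - left_slope u.
  apply/cvgrPdist_lt => e e0.
  have /cvgrPdist_lt /(_ _ e0) /nbhs_left0P lF := cvg_left_slope u01.
  near=> h.
  have h0 : 0 < h by near: h; exact: nbhs_right_gt.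
  have hu : h < u by near: h; exact: nbhs_right_lt.
  have -> : G h = - slope (u - h) u.
    rewrite /G /slope Fu Ff; last by apply/andP; split; lra.
    have -> : u - (u - h) = h by lra.
    have -> : 1 - (u - h) = h + (1 - u) by lra.
    by rewrite -mulNr opprB mulrC.
  by rewrite -opprD normrN; near: h.
have left_cvg : G @ 0^'- --> - right_slope u.
  apply/cvgrPdist_lt => e e0.
  have /cvgrPdist_lt /(_ _ e0) /nbhs_right0P rF := cvg_right_slope u01.
  apply/nbhs_left0P; near=> h.
  have h0 : 0 < h by near: h; exact: nbhs_right_gt.
  have hu : h < 1 - u by near: h; apply: nbhs_right_lt; rewrite subr_gt0.
  have -> : G (0 - h) = - slope u (u + h).
    rewrite /G /slope Fu Ff; last by apply/andP; split; lra.
    have -> : u + h - u = h by lra.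
    have -> : 1 - (u + h) = 0 - h + (1 - u) by lra.
    by rewrite sub0r invrN scaleNr mulrC.
  by rewrite -opprD normrN; near: h.
rewrite /two_sided_slope; case: ifPn => [/eqP lr|/eqP lr].
  apply/cvg_lim => //; apply: (@cvg_at_right_left_dnbhs _ R^o) => //.
  by rewrite -lr.
(* A two-sided limit would coincide with both one-sided limits and force the slopes to agree. *)
rewrite opprK dvgP//; apply/cvg_ex => -[l Gl]; apply: lr.
apply: oppr_inj.
rewrite (cvg_unique (@Rhausdorff R) right_cvg (cvg_dnbhs_at_right Gl)).
exact: cvg_unique (cvg_dnbhs_at_left Gl) left_cvg.
Unshelve. all: by end_near. Qed.

End one_sided_derivatives.

(** * Integration of a subgradient of a convex function *)

Section subgradient_integral.
Context (R : realType) (F D : R -> R).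
Notation mu := (@lebesgue_measure R).

Hypothesis subgrad : forall u v : R, 0 < u -> u < v -> v < 1 ->
  D u * (v - u) <= F v - F u <= D v * (v - u).

Let ndD (u v : R) : 0 < u -> u <= v -> v < 1 -> D u <= D v.
Proof.
move=> u0; rewrite le_eqVlt => /predU1P[->//|uv] v1.
have /andP[h1 h2] := subgrad u0 uv v1.
by have := le_trans h1 h2; rewrite ler_pM2r// subr_gt0.
Qed.

(** [D] is nondecreasing, so preimages of rays are intervals. *)
Lemma measurable_subgradient : measurable_fun (`]0, 1[ : set R) D.
Proof.
move=> mI; apply: (measurability (@RGenCInfty.G R)) => //.
  exact: RGenCInfty.measurableE.
move=> /= _ [_] [r] -> <-; apply: is_interval_measurable => s t/=.
rewrite !in_itv/= !andbT => -[/andP[s0 s1] fs] [/andP[t0 t1] ft] u /andP[su ut].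
split; first by rewrite in_itv/= (lt_le_trans s0)// (le_lt_trans ut).
rewrite in_itv/= andbT (le_trans fs)// ndD// (le_lt_trans ut)//.
Qed.

Let sub01 (a b : R) : 0 < a -> b < 1 -> `]a, b] `<=` (`]0, 1[ : set R).
Proof.
move=> a0 b1 x /=; rewrite !in_itv/= => /andP[ax xb].
by rewrite (lt_trans a0)// (le_lt_trans xb).
Qed.

Lemma integrable_subgradient (a b : R) : 0 < a -> b < 1 ->
  mu.-integrable `]a, b] (EFin \o D).
Proof.
move=> a0 b1; apply: measurable_bounded_integrable => //.
- by rewrite /= lebesgue_measure_itv/=; case: ifP => // _; rewrite -EFinB ltry.
- by apply: measurable_funS measurable_subgradient => //; exact: sub01.
exists (`|D a| + `|D b|); split; first exact: num_real.
move=> x xM y; rewrite /= in_itv/= => /andP[ay yb]; apply/ltW/(le_lt_trans _ xM).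
have le1 : D a <= D y by apply: ndD; rewrite ?(le_lt_trans yb)// ltW.
have le2 : D y <= D b by apply: ndD => //; exact: lt_trans ay.
have := ler_norm (D b); have := lerNnormlW (lexx `|D a|).
have := normr_ge0 (D b); have := normr_ge0 (D a).
by rewrite ler_norml => *; apply/andP; split; lra.
Qed.

Let defect a b := \int[mu]_(x in `]a, b]) D x - (F b - F a).

Let integral_cst_itv (a b c : R) : a < b ->
  \int[mu]_(x in `]a, b]) c = c * (b - a).
Proof.
move=> ab; rewrite Rintegral_cst//; congr (_ * _).
by rewrite [X in fine X]lebesgue_measure_itv/= lte_fin ab.
Qed.

(** Both the integral of [D] and the increment of [F] lie between [D a * (b - a)] and
    [D b * (b - a)]. *)
Let defect_le (a b : R) : 0 < a -> a < b -> b < 1 ->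
  `|defect a b| <= (D b - D a) * (b - a).
Proof.
move=> a0 ab b1; have /andP[h1 h2] := subgrad a0 ab b1.
have iD := integrable_subgradient a0 b1.
have cst_int (c : R) : mu.-integrable `]a, b] (EFin \o fun=> c).
  apply: measurable_bounded_integrable => //.
    by rewrite /= lebesgue_measure_itv/=; case: ifP => // _; rewrite -EFinB ltry.
  exact: bounded_cst.
have l1 : D a * (b - a) <= \int[mu]_(x in `]a, b]) D x.
  rewrite -(integral_cst_itv _ ab); apply: le_Rintegral => //.
  move=> x; rewrite /= in_itv/= => /andP[ax xb].
  by apply: ndD => //; [exact: ltW|exact: le_lt_trans b1].
have l2 : \int[mu]_(x in `]a, b]) D x <= D b * (b - a).
  rewrite -(integral_cst_itv _ ab); apply: le_Rintegral => //.
  move=> x; rewrite /= in_itv/= => /andP[ax xb].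
  by apply: ndD => //; exact: lt_trans ax.
by rewrite /defect ler_norml; apply/andP; split; lra.
Qed.

Let defectD (a b c : R) : 0 < a -> a < b -> b < c -> c < 1 ->
  defect a c = defect a b + defect b c.
Proof.
move=> a0 ab bc c1; rewrite /defect -(@Rintegral_itvB _ D (BRight a) _ b).
- by lra.
- exact: integrable_subgradient.
- by rewrite bnd_simp ltW.
- by rewrite bnd_simp ltW.
Qed.

(* Over a uniform partition of mesh [h] the defects telescope to at most
   [(D b - D a) * h]. *)
Lemma integral_subgradient (a b : R) : 0 < a -> a < b -> b < 1 ->
  \int[mu]_(x in `]a, b]) D x = F b - F a.
Proof.
move=> a0 ab b1; apply/eqP; rewrite -subr_eq0 -normr_le0.
have part n : `|defect a b| <= (D b - D a) * ((b - a) / n.+1%:R).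
  set h := (b - a) / n.+1%:R.
  have h0 : 0 < h by rewrite divr_gt0// subr_gt0.
  have bE : b = a + n.+1%:R * h by rewrite /h mulrC divfK// addrC subrK.
  suff ind i : (i <= n)%N ->
      `|defect a (a + i.+1%:R * h)| <= (D (a + i.+1%:R * h) - D a) * h.
    by rewrite {1 2}bE; exact: ind.
  have lt1 j : (j <= n)%N -> a + j.+1%:R * h < 1.
    move=> jn; apply: le_lt_trans b1; rewrite bE lerD2l ler_wpM2r ?(ltW h0)//.
    by rewrite ler_nat.
  elim: i => [|i ih] ilen.
    have := @defect_le a (a + 1 * h); rewrite mul1r.
    have -> : a + h - a = h by lra.
    by apply=> //; [lra|have := lt1 0%N isT; rewrite mul1r].
  have ih' := ih (ltnW ilen).
  have e2 : a + i.+2%:R * h = a + i.+1%:R * h + h by rewrite -natr1; lra.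
  have l1 : a < a + i.+1%:R * h by rewrite ltrDl mulr_gt0.
  have l2 : a + i.+1%:R * h < a + i.+2%:R * h by rewrite e2 ltrDl.
  rewrite (defectD a0 l1 l2 (lt1 _ ilen)).
  apply: le_trans (ler_normD _ _) _.
  have := defect_le (lt_trans a0 l1) l2 (lt1 _ ilen).
  have -> : a + i.+2%:R * h - (a + i.+1%:R * h) = h by rewrite e2; lra.
  by move=> ?; lra.
rewrite -/(defect a b); apply/ler_addgt0Pr => e e0; rewrite add0r.
set C := (D b - D a) * (b - a).
have C0 : 0 <= C by rewrite mulr_ge0 ?subr_ge0 ?ndD ?ltW.
(* With more than [C / e] subintervals the bound [C / n.+1] drops below [e]. *)
apply: le_trans (part (Num.truncn (C / e))) _.
rewrite mulrA -/C ler_pdivrMr// mulrC -ler_pdivrMr//.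
exact/ltW/truncnS_gt.
Qed.

End subgradient_integral.

Section density_measure.
Context d (T : measurableType d) (R : realType) (P : probability T R).
Variables (z : T -> R) (mz : measurable_fun setT z) (z0 : forall x, 0 <= z x).

(** The two facts about [z] are arguments so that the measure structure can be attached to the
    resulting term. *)
Definition density_measure of measurable_fun setT z & (forall x, 0 <= z x) :=
  fun A : set T => (\int[P]_(x in A) (z x)%:E)%E.

Notation nu := (density_measure mz z0).

Let nu0 : nu set0 = 0%E. Proof. exact: integral_set0. Qed.

Let nu_ge0 A : (0 <= nu A)%E.
Proof. by apply: integral_ge0 => x _; rewrite lee_fin. Qed.

Let nu_sigma_additive : semi_sigma_additive nu.
Proof.
move=> /= F mF tF mUF; rewrite /density_measure; apply: cvg_toP.
  apply: ereal_nondecreasing_is_cvgn => m n mn.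
  apply: lee_sum_nneg_natr => // k _ _.
  by apply: integral_ge0 => /= x Fkx; rewrite lee_fin.
rewrite ge0_integral_bigcup//=.
- by apply/measurable_EFinP; exact: measurable_funTS.
- by move=> x _; rewrite lee_fin.
Qed.

HB.instance Definition _ :=
  isMeasure.Build _ _ _ nu nu0 nu_ge0 nu_sigma_additive.

End density_measure.

Section density_probability.
Context d (T : measurableType d) (R : realType) (P : probability T R).
Variables (z : T -> R) (mz : measurable_fun setT z) (z0 : forall x, 0 <= z x).
Hypothesis z1 : (\int[P]_x (z x)%:E = 1)%E.

Let nu := density_measure P mz z0.

HB.instance Definition _ := Measure.on nu.

Let nu_setT : nu setT = 1%E. Proof. exact: z1. Qed.

HB.instance Definition _ := Measure_isProbability.Build _ _ _ nu nu_setT.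

Definition density_probability : probability T R := nu.

End density_probability.

(** * The density of the canonical representation *)

Section canonical_density.
Context (R : realType) (f : R -> R) (Q : probability (measurableTypeR R) R).
Hypotheses (f_tradeoff : is_tradeoff f) (f0 : f 0 = 1).
Hypothesis fQ : canonical_rep f Q.

Notation mu := (@lebesgue_measure R).
Let F x := f (1 - x).

Let F_convex (u v w : R) : 0 < u -> u < v -> v < w -> w < 1 ->
  (w - u) * F v <= (w - v) * F u + (v - u) * F w.
Proof.
move=> u0 uv vw w1; have [d [W [P0 [Q0 fE]]]] := f_tradeoff.
have wu : 0 < w - u by lra.
have a0 : 0 <= 1 - u by lra.
have b0 : 0 <= 1 - w by lra.
have t01 : 0 <= (w - v) / (w - u) <= 1.
  apply/andP; split; first by apply: divr_ge0; lra.
  by rewrite ler_pdivrMr// mul1r; lra.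
have := tradeoff_convex P0 Q0 a0 b0 t01.
have -> : (w - v) / (w - u) * (1 - u) + (1 - (w - v) / (w - u)) * (1 - w) =
  1 - v by field; rewrite gt_eqF//.
rewrite -!fE; try (by apply/andP; split; lra).
rewrite -(ler_pM2l wu) /F => /le_trans; apply.
rewrite le_eqVlt; apply/orP; left; apply/eqP; field; rewrite gt_eqF//.
Qed.

Let QF (x : R) : 0 <= x < 1 -> Q `[0, x]%classic = (F x)%:E.
Proof. exact: fQ.2. Qed.

Let F_nondecreasing (u v : R) : 0 <= u -> u <= v -> v < 1 -> F u <= F v.
Proof.
move=> u0 uv v1; rewrite -lee_fin -!QF; [|by apply/andP; split; lra..].
by apply: le_measure; rewrite ?inE//; exact: subset_itvl.
Qed.

(** A trade-off function vanishes at 1, so [Q] has no atom at 0, and [Q] is continuous from above.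
    The index [n.+2] keeps the points inside []0, 1[]. *)
Let cvg_F0 : F n.+2%:R^-1 @[n --> \oo] --> (0 : R).
Proof.
have [d [W [P0 [Q0 fE]]]] := f_tradeoff.
have F0 : F 0 = 0 by rewrite /F subr0 fE ?ler01 ?lexx// tradeoff1.
have inv01 n : 0 <= (n.+2%:R^-1 : R) < 1.
  by rewrite invr_ge0 ler0n/= invf_lt1// ltr1n.
have FE n : F n.+2%:R^-1 = fine (Q `[0, n.+2%:R^-1]%classic).
  by rewrite QF.
under eq_cvg do rewrite FE.
have Q00 : Q `[0, 0]%classic = 0%:E by rewrite QF ?lexx ?ltr01// F0.
apply: fine_cvg; rewrite -Q00.
have -> : `[0, 0]%classic = \bigcap_n `[0, (n.+2%:R^-1 : R)]%classic.
  apply/seteqP; split=> [x /= + n _|x /= xn].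
    rewrite /= !in_itv/= => /andP[-> /le_trans]; apply.
    by have /andP[] := inv01 n.
  have := xn 0%N I; rewrite /= !in_itv/= => /andP[x0 _]; rewrite x0/= leNgt.
  apply/negP => xgt0; have := xn (Num.truncn x^-1) I.
  rewrite /= in_itv/= x0/= leNgt => /negP; apply.
  rewrite invf_plt ?posrE//; apply: lt_trans (truncnS_gt _) _.
  by rewrite ltr_nat.
apply: (@nonincreasing_cvg_mu _ _ _ Q (fun n => `[0, n.+2%:R^-1]%classic)) => //.
- by rewrite -ge0_fin_numE//; exact: fin_num_measure.
- by apply: bigcap_measurable => //; exists 0%N.
- move=> m n mn; apply/subsetPset; apply: subset_itvl.
  by rewrite bnd_simp lef_pV2 ?posrE// ler_nat.
Qed.

(** This is where [f 0 = 1] enters: [f] is continuous at 0, so the mass of [[0, 1[] under [Q] is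
    already 1. *)
Let cvg_F1 : F (1 - n.+2%:R^-1) @[n --> \oo] --> (1 : R).
Proof.
have [d [W [P0 [Q0 fE]]]] := f_tradeoff.
have T0 : tradeoff P0 Q0 0 = 1 by rewrite -fE ?f0// lexx ler01.
apply/cvgrPdist_le => e e0.
have [r r0 rP] := tradeoff_near0 T0 e0.
near=> n.
have n0 : 0 < n.+2%:R^-1 :> R by rewrite invr_gt0.
have n1 : n.+2%:R^-1 < 1 :> R by rewrite invf_lt1// ltr1n.
have nr : n.+2%:R^-1 <= r.
  rewrite invf_ple ?posrE//.
  near: n; exists (Num.truncn r^-1) => // n /= rn.
  apply/ltW/(lt_le_trans (truncnS_gt _)); rewrite ler_nat.
  exact: (leq_trans rn (leqnSn n)).
have F1 : 1 - e <= F (1 - n.+2%:R^-1).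
  rewrite /F subKr fE; first by apply: rP; rewrite ltW.
  by rewrite !ltW.
have F2 : F (1 - n.+2%:R^-1) <= 1.
  rewrite -lee_fin -QF ?probability_le1// subr_ge0 (ltW n1)/=.
  by rewrite ltrBlDr ltrDl.
rewrite ger0_norm ?subr_ge0//; move: F1; set y := F _; lra.
Unshelve. all: by end_near. Qed.

(** Kept convertible to the argument of the logarithm in [log_lr]. *)
Definition canonical_lr (x : R) := `|(derive1 f \_ `]0, 1[) (1 - x)|.

Let canonical_lrE (x : R) : 0 < x < 1 ->
  canonical_lr x = `|two_sided_slope F x|.
Proof.
move=> x01; rewrite /canonical_lr patchE mem_set; last first.
  by rewrite /= in_itv/=; apply/andP; split; lra.
by rewrite (derive1_reflect F_convex)// normrN.
Qed.

Let canonical_lr_out (x : R) : ~~ (0 < x < 1) -> canonical_lr x = 0.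
Proof.
move=> x01; rewrite /canonical_lr patchE memNset ?normr0//=.
rewrite in_itv/= => /andP[? ?]; move/negP : x01; apply.
by apply/andP; split; lra.
Qed.

Let subgrad_right (u v : R) : 0 < u -> u < v -> v < 1 ->
  right_slope F u * (v - u) <= F v - F u <= right_slope F v * (v - u).
Proof.
move=> u0 uv v1; have uv0 : 0 < v - u by rewrite subr_gt0.
apply/andP; split; [rewrite -ler_pdivlMr//|rewrite -ler_pdivrMr//].
  by apply: (right_slope_le F_convex) => //; rewrite u0 (lt_trans uv).
by apply: (right_slope_ge F_convex) => //; rewrite v1 (lt_trans u0).
Qed.

Let subgrad_left (u v : R) : 0 < u -> u < v -> v < 1 ->
  left_slope F u * (v - u) <= F v - F u <= left_slope F v * (v - u).
Proof.
move=> u0 uv v1; have uv0 : 0 < v - u by rewrite subr_gt0.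
apply/andP; split; [rewrite -ler_pdivlMr//|rewrite -ler_pdivrMr//].
  by apply: (left_slope_le F_convex) => //; rewrite u0 (lt_trans uv).
by apply: (left_slope_ge F_convex) => //; rewrite v1 (lt_trans u0).
Qed.

(** The kinks form the set where two measurable functions, the left and right slopes, differ.
    Outside []0, 1[] both restrictions are 0, which is also the value of [canonical_lr]. *)
Lemma measurable_canonical_lr : measurable_fun setT canonical_lr.
Proof.
pose I := `]0, 1[%classic : set R.
pose l := left_slope F \_ I; pose r := right_slope F \_ I.
have ml : measurable_fun setT l.
  apply/(measurable_restrictT _ _).1; first exact: measurable_itv.
  exact: (measurable_subgradient subgrad_left).
have mr : measurable_fun setT r.
  apply/(measurable_restrictT _ _).1; first exact: measurable_itv.
  exact: (measurable_subgradient subgrad_right).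
rewrite (_ : canonical_lr = fun x => `|if l x == r x then r x else - point|).
  apply: measurableT_comp => //; apply: measurable_fun_ifT => //.
  exact: measurable_fun_eqr.
apply/funext => x; have [x01|x01] := boolP (0 < x < 1).
  by rewrite canonical_lrE// /l /r !patchE mem_set// /I/= in_itv.
rewrite canonical_lr_out// /l /r !patchE memNset ?eqxx ?normr0//.
by rewrite /I/= in_itv/=; exact/negP.
Qed.

Let right_slope_ge0 (u : R) : 0 < u < 1 -> 0 <= right_slope F u.
Proof.
move=> /andP[u0 u1]; have h0 : 0 < u / 2 by rewrite divr_gt0.
have h1 : u / 2 < u by lra.
have u01 : 0 < u < 1 by rewrite u0.
apply: le_trans (right_slope_ge F_convex u01 h0 h1).
rewrite divr_ge0 ?subr_ge0 ?(ltW h1)//.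
by apply: F_nondecreasing => //; exact: ltW.
Qed.

(** The left and right slopes are both subgradients, so they have the same integral; being ordered,
    they agree almost everywhere. Kinks, and the default value there, are therefore negligible. *)
Let integral_lr_itv (a b : R) : 0 < a -> a < b -> b < 1 ->
  (\int[@unif R]_(x in `]a, b]) (canonical_lr x)%:E = (F b - F a)%:E)%E.
Proof.
move=> a0 ab b1.
have sub01 x : x \in (`]a, b]%classic : set R) -> 0 < x < 1.
  rewrite inE/= in_itv/= => /andP[ax xb].
  by rewrite (lt_trans a0)// (le_lt_trans xb).
rewrite integral_mkcond integral_uniform//; last 2 first.
- apply/(measurable_restrictT _ _).1 => //; apply/measurable_EFinP.
  by apply: measurable_funTS; exact: measurable_canonical_lr.
- by move=> x; apply: erestrict_ge0 => y _; rewrite lee_fin normr_ge0.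
rewrite subr0 invr1 mul1e -integral_mkcondr.
rewrite (_ : `[0%R, 1%R] `&` `]a, b] = `]a, b]%classic); last first.
  apply/setIidr => x /mem_set/sub01/andP[x0 x1].
  by rewrite /= in_itv/= !ltW.
have il := integrable_subgradient subgrad_left a0 b1.
have ir := integrable_subgradient subgrad_right a0 b1.
have El := integral_subgradient subgrad_left a0 ab b1.
have Er := integral_subgradient subgrad_right a0 ab b1.
have ae : ae_eq mu (`]a, b]%classic : set R)
    (EFin \o (fun x => right_slope F x - left_slope F x)) (cst 0%E).
  have irl : mu.-integrable `]a, b]
      (EFin \o (fun x => right_slope F x - left_slope F x)).
    exact: (integrableB _ ir il).
  apply/ae_eq_integral_abs => //; first exact: measurable_int irl.
  transitivity (\int[mu]_(x in `]a, b]) (right_slope F x - left_slope F x)%:E)%E.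
    apply: eq_integral => x /sub01 x01; rewrite gee0_abs// lee_fin subr_ge0.
    exact: left_le_right_slope F_convex _ x01.
  rewrite -[LHS]fineK; last exact: integrable_fin_num irl.
  by congr EFin; rewrite -/(Rintegral _ _ _) RintegralB// El Er subrr.
rewrite -Er /Rintegral fineK; last exact: integrable_fin_num ir.
apply: ae_eq_integral => //.
- by apply/measurable_EFinP; apply: measurable_funTS; exact: measurable_canonical_lr.
- exact: measurable_int ir.
apply: filterS ae => x /= h xab; have [e] := h xab.
have x01 := sub01 x (mem_set xab).
congr EFin; rewrite canonical_lrE// /two_sided_slope.
have -> : left_slope F x = right_slope F x by lra.
by rewrite eqxx ger0_norm// right_slope_ge0.
Qed.

(** Integrals are known only on []a, b]] with [0 < a] and [b < 1]. Monotone limits together with the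
    boundary values of [F] extend them to all rays []x, +oo[], which determine a probability
    measure. *)
Lemma has_density_canonical : has_density (@unif R) Q canonical_lr.
Proof.
have q0 x : 0 <= canonical_lr x by exact: normr_ge0.
split; [exact: measurable_canonical_lr|by []|].
pose nu := density_measure (@unif R) measurable_canonical_lr q0.
have nuE a b : 0 < a -> a < b -> b < 1 -> nu `]a, b]%classic = (F b - F a)%:E.
  exact: integral_lr_itv.
have inv01 n : 0 < (n.+2%:R^-1 : R) < 1.
  by rewrite invr_gt0 ltr0n/= invf_lt1// ltr1n.
have inv_small (e : R) : 0 < e -> \forall n \near \oo, n.+2%:R^-1 < e.
  move=> e0; exists (Num.truncn e^-1) => // n /= rn.
  rewrite invf_plt ?posrE//; apply: (lt_le_trans (truncnS_gt _)); rewrite ler_nat.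
  exact: (leq_trans rn (leqnSn n)).
(* The density vanishes outside []0, 1[], so rays may be exchanged with increasing unions that agree
   with them there. *)
have nu_eq (A B : set R) :
    (forall y, 0 < y < 1 -> A y <-> B y) -> nu A = nu B.
  move=> AB; rewrite /nu /density_measure integral_mkcond [RHS]integral_mkcond.
  apply: eq_integral => y _; rewrite !patchE.
  have [y01|y01] := boolP (0 < y < 1).
    by congr (if _ then _ else _); apply/idP/idP; rewrite !inE => /(AB y y01).
  by rewrite canonical_lr_out// !if_same.
have nu_ge1 x : 1 <= x -> nu `]x, +oo[%classic = 0%E.
  move=> x1; apply: integral0_eq => y; rewrite /= in_itv/= andbT => xy.
  rewrite canonical_lr_out//; apply/negP => /andP[_ y1].
  by have := lt_trans (le_lt_trans x1 xy) y1; rewrite ltxx.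
have nu_in x : 0 < x < 1 -> nu `]x, +oo[%classic = (1 - F x)%:E.
  move=> /andP[x0 x1].
  have -> : nu `]x, +oo[%classic = nu (\bigcup_n `]x, 1 - n.+2%:R^-1]%classic).
    apply: nu_eq => y /andP[y0 y1]; split => [|[n _]]; rewrite /= !in_itv/= ?andbT.
      move=> xy; have := inv_small (1 - y); rewrite subr_gt0 => /(_ y1)[n _ nP].
      exists n => //=; rewrite in_itv/= xy/= lerBrDr -lerBrDl.
      by apply/ltW/nP; exact: leqnn.
    by case/andP.
  have cvg_nu : nu `]x, 1 - n.+2%:R^-1]%classic @[n --> \oo] -->
      nu (\bigcup_n `]x, 1 - n.+2%:R^-1]%classic).
    apply: (@nondecreasing_cvg_mu _ _ _ nu).
    - by move=> n; exact: measurable_itv.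
    - by apply: bigcupT_measurable => n; exact: measurable_itv.
    - move=> m n mn; apply/subsetPset; apply: subset_itvl.
      by rewrite bnd_simp lerD2l lerN2 lef_pV2 ?posrE// ler_nat.
  rewrite -(cvg_lim _ cvg_nu)//; apply/cvg_lim => //.
  apply: (@cvg_trans _ ((F (1 - n.+2%:R^-1) - F x)%:E @[n --> \oo])).
    apply: near_eq_cvg; near=> n; rewrite nuE//.
    rewrite ltrBrDl -ltrBrDr; near: n; apply: inv_small.
    by rewrite subr_gt0.
  apply: cvg_EFin; first exact: nearW.
  by apply: cvgB => //; exact: cvg_cst.
have nu_le0 x : x <= 0 -> nu `]x, +oo[%classic = 1%E.
  move=> x0.
  have -> : nu `]x, +oo[%classic = nu (\bigcup_n `]n.+2%:R^-1, +oo[%classic).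
    apply: nu_eq => y /andP[y0 y1]; split => [|[n _]]; rewrite /= !in_itv/= ?andbT.
      move=> xy; have [n _ nP] := inv_small y y0.
      by exists n => //=; rewrite in_itv/= andbT; apply: nP; exact: leqnn.
    by move=> _; exact: le_lt_trans y0.
  have cvg_nu : nu `]n.+2%:R^-1, +oo[%classic @[n --> \oo] -->
      nu (\bigcup_n `](n.+2%:R^-1 : R), +oo[%classic).
    apply: (@nondecreasing_cvg_mu _ _ _ nu).
    - by move=> n; exact: measurable_itv.
    - by apply: bigcupT_measurable => n; exact: measurable_itv.
    - move=> m n mn; apply/subsetPset; apply: subset_itvr.
      by rewrite bnd_simp lef_pV2 ?posrE// ler_nat.
  rewrite -(cvg_lim _ cvg_nu)//; apply/cvg_lim => //.
  under eq_cvg do rewrite nu_in//.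
  apply: cvg_EFin; first exact: nearW.
  by rewrite -[X in _ --> X]subr0; apply: cvgB => //; exact: cvg_cst.
have Q01 := fQ.1.
(* The analogue for [Q], which is carried by the closed interval: the endpoints now count. *)
have Q_eq (A B : set R) : measurable A -> measurable B ->
    (forall y, 0 <= y <= 1 -> A y <-> B y) -> Q A = Q B.
  move=> mA mB AB.
  have QI (C : set R) : measurable C -> Q C = Q (C `&` `[0, 1]).
    move=> mC; rewrite -[in LHS](setIT C) -(setUv `[0, 1]%classic) setIUr.
    rewrite measureU//; last 3 first.
    - exact: measurableI.
    - by apply: measurableI => //; exact: measurableC.
    - by rewrite setIACA setICr setI0.
    rewrite [X in (_ + X)%E](_ : _ = 0%E) ?adde0//.
    apply/eqP; rewrite eq_le measure_ge0 andbT.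
    have <- : Q (~` `[0, 1]%classic) = 0%E by rewrite probability_setC// Q01 subee.
    apply: le_measure; rewrite ?inE//.
    + by apply: measurableI => //; exact: measurableC.
    + exact: measurableC.
  rewrite (QI A)// (QI B)//; congr (Q _); apply/seteqP.
  by split => y [+ y01]; move: (y01); rewrite /= in_itv/= => /AB h /h.
change (forall A : set (measurableTypeR R), measurable A -> Q A = nu A).
apply: (@measure_unique _ _ (measurableTypeR R) (@RGenOInfty.G R)
    (fun n => `]- n%:R, +oo[%classic)).
- exact: RGenOInfty.measurableE.
- move=> _ _ [x ->] [y ->]; exists (Num.max x y).
  apply/seteqP; split => z /=; rewrite !in_itv/= !andbT gt_max.
    by case=> -> ->.
  by move/andP.
- by move=> n; eexists.
- apply/seteqP; split => // x _; exists (Num.truncn `|x|).+1 => //=.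
  rewrite in_itv/= andbT ltrNl; apply: le_lt_trans (truncnS_gt _).
  by rewrite -normrN ler_norm.
- move=> _ [x ->]; change (Q `]x, +oo[%classic = nu `]x, +oo[%classic).
  have [x0|x0] := ltP x 0.
    rewrite nu_le0 ?ltW// -Q01; apply: Q_eq => // y /andP[y0 y1].
    by rewrite /= !in_itv/= andbT y0 y1 (lt_le_trans x0).
  have [x1|x1] := leP 1 x.
    rewrite nu_ge1// -(measure0 Q); apply: Q_eq => // y /andP[y0 y1].
    by rewrite /= in_itv/= andbT ltNge (le_trans y1).
  have QC : Q (~` `[0, x]%classic) = (1 - F x)%:E.
    by rewrite probability_setC// QF ?x0.
  transitivity (Q (~` `[0, x]%classic)).
    apply: Q_eq => //; first exact: measurableC.
    move=> y /andP[y0 y1]; rewrite /= !in_itv/= andbT y0/=.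
    by rewrite ltNge; split => [/negP//|h]; exact/negP.
  rewrite QC.
  (* At [x = 0] both sides are 1, because [F 0 = f 1 = 0]. *)
  have [xE|xE] := eqVneq x 0; last by rewrite nu_in// x1 lt_neqAle eq_sym xE x0.
  rewrite nu_le0 ?xE//; have := tradeoff1; have [d [W [P0 [Q0 fE]]]] := f_tradeoff.
  by move=> /(_ _ W _ P0 Q0); rewrite /F subr0 fE ?ler01 ?lexx// => ->; rewrite subr0.
- by move=> n; rewrite -ge0_fin_numE//; exact: fin_num_measure.
Unshelve. all: by end_near. Qed.

End canonical_density.

(** * Products and random samples *)

Section density_constructions.
Context (R : realType).

Lemma has_density_integral d (T : measurableType d) (P Q : probability T R)
    (z : T -> R) (h : T -> \bar R) : has_density P Q z ->
  measurable_fun setT h -> (forall x, 0 <= h x)%E ->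
  (\int[Q]_x h x = \int[P]_x (h x * (z x)%:E))%E.
Proof. by move=> [mz z0 Qz]; exact: ge0_integral_density. Qed.

(** Densities are established in this integrated form because it passes through image measures,
    products and mixtures. *)
Lemma has_densityI d (T : measurableType d) (P Q : probability T R)
    (z : T -> R) : measurable_fun setT z -> (forall x, 0 <= z x) ->
  (forall h : T -> \bar R, measurable_fun setT h -> (forall x, 0 <= h x)%E ->
    (\int[Q]_x h x = \int[P]_x (h x * (z x)%:E))%E) ->
  has_density P Q z.
Proof.
move=> mz z0 E; split=> // A mA.
transitivity (\int[Q]_x (\1_A x)%:E)%E; first by rewrite integral_indic// setIT.
rewrite E//; last exact/measurable_EFinP/measurable_indic.
by rewrite [RHS]integral_mkcond; apply: eq_integral => x _;
    rewrite patchE indicE; case: ifP => _; rewrite ?mul1e ?mul0e.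
Qed.

Lemma has_density_distribution d (T : measurableType d)
    d' (T' : measurableType d') (P Q : probability T R)
    (phi : {mfun T >-> T'}) (z : T' -> R) :
  measurable_fun setT z -> (forall y, 0 <= z y) ->
  has_density P Q (z \o phi) ->
  has_density (distribution P phi) (distribution Q phi) z.
Proof.
move=> mz z0 PQ; apply: has_densityI => // h mh h0.
rewrite !ge0_integral_pushforward//.
- rewrite !preimage_setT (has_density_integral PQ)//.
    exact: measurableT_comp.
  by move=> x /=.
- by apply: emeasurable_funM => //; exact/measurable_EFinP.
- by move=> y _; rewrite mule_ge0// lee_fin.
Qed.

Lemma has_density_product d1 (T1 : measurableType d1)
    d2 (T2 : measurableType d2) (P1 Q1 : probability T1 R)
    (P2 Q2 : probability T2 R) (z1 : T1 -> R) (z2 : T2 -> R) :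
  has_density P1 Q1 z1 -> has_density P2 Q2 z2 ->
  has_density (product_probability P1 P2) (product_probability Q1 Q2)
    (fun x => z1 x.1 * z2 x.2).
Proof.
move=> d1' d2'; have [mz1 z10 _] := d1'; have [mz2 z20 _] := d2'.
have mz1' : measurable_fun setT (fun x : T1 * T2 => z1 x.1).
  exact: measurableT_comp.
have mz2' : measurable_fun setT (fun x : T1 * T2 => z2 x.2).
  exact: measurableT_comp.
apply: has_densityI.
- exact: measurable_funM.
- by move=> x; rewrite mulr_ge0.
move=> h mh h0.
transitivity (\int[Q1]_x \int[Q2]_y h (x, y))%E.
  exact: (@fubini_tonelli1 _ _ _ _ _ Q1 Q2 h mh h0).
transitivity (\int[Q1]_x \int[P2]_y (h (x, y) * (z2 y)%:E))%E.
  apply: eq_integral => x _; apply: (has_density_integral d2') => //.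
  exact: measurableT_comp.
have mh2 : measurable_fun setT (fun x : T1 * T2 => h x * (z2 x.2)%:E)%E.
  by apply: emeasurable_funM => //; exact/measurable_EFinP.
have h20 x : (0 <= h x * (z2 x.2)%:E)%E by rewrite mule_ge0// lee_fin.
rewrite (has_density_integral d1'); last 2 first.
- exact: (@measurable_fun_fubini_tonelli_F _ _ _ _ _ P2 _ mh2 h20).
- by move=> x; apply: integral_ge0 => y _; exact: (h20 (x, y)).
transitivity (\int[P1]_x \int[P2]_y (h (x, y) * (z1 x * z2 y)%:E))%E.
  apply: eq_integral => x _; rewrite muleC -ge0_integralZl//; last 2 first.
  - exact: (measurableT_comp mh2 (pair1_measurable x)).
  - by rewrite lee_fin.
  by apply: eq_integral => y _; rewrite EFinM muleCA.
apply/esym; apply: (@fubini_tonelli1 _ _ _ _ _ P1 P2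
  (fun x => h x * (z1 x.1 * z2 x.2)%:E)%E).
- by apply: emeasurable_funM => //; apply/measurable_EFinP; exact: measurable_funM.
- by move=> x; rewrite mule_ge0// lee_fin mulr_ge0.
Qed.

Lemma measurable_prod_tnth d (T : measurableType d) (z : T -> R) k :
  measurable_fun setT z ->
  measurable_fun setT (fun x : k.-tuple T => \prod_(i < k) z (tnth x i)).
Proof.
move=> mz; elim: (index_enum _) => [|i s ih].
  by under eq_fun do rewrite big_nil; exact: measurable_cst.
under eq_fun do rewrite big_cons; apply: measurable_funM => //.
by apply: measurableT_comp => //; exact: measurable_tnth.
Qed.

Lemma has_density_power d (T : measurableType d) (P Q : probability T R)
    (z : T -> R) k : has_density P Q z ->
  has_density (power_prob P k) (power_prob Q k)
    (fun x => \prod_(i < k) z (tnth x i)).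
Proof.
move=> dz; have [mz z0 _] := dz.
elim: k => [|k ih].
  apply: has_densityI.
  - exact: measurable_prod_tnth.
  - by move=> x; rewrite prodr_ge0.
  - by move=> h mh h0 /=; apply: eq_integral => x _; rewrite big_ord0 mule1.
apply: has_density_distribution.
- exact: measurable_prod_tnth.
- by move=> x; rewrite prodr_ge0.
have := has_density_product dz ih; congr (has_density _ _ _).
apply/funext => -[x t] /=; rewrite big_ord_recl; congr (_ * _).
by apply: eq_bigr => i _; rewrite tnthS.
Qed.

Definition random_power_lr (T : Type) (z : T -> R) (s : finite_sample T) : R :=
  \prod_(i < tag s) z (tnth (tagged s) i).

Lemma measurable_finite_sample d (T : measurableType d)
    d' (T' : measurableType d') (g : finite_sample T -> T') :
  (forall k, measurable_fun setT (fun x : k.-tuple T => g (existT _ k x))) ->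
  measurable_fun setT g.
Proof.
move=> mg _ B mB; rewrite setTI.
change (finite_sample_measurable (g @^-1` B)) => k.
by have := mg k measurableT B mB; rewrite setTI.
Qed.

Lemma measurable_existT d (T : measurableType d) k :
  measurable_fun setT (fun x : k.-tuple T => existT _ k x : finite_sample T).
Proof. by move=> _ A mA; rewrite setTI; exact: mA. Qed.

Definition sample_of_tuple (T : Type) k (x : k.-tuple T) : finite_sample T :=
  existT (fun k => k.-tuple T) k x.

HB.instance Definition _ d (T : measurableType d) k :=
  isMeasurableFun.Build _ _ _ _ (@sample_of_tuple T k)
    (@measurable_existT d T k).

(** The law of the random sample is a countable mixture of images of the power measures, so
    integrals are computed term by term. *)
Lemma ge0_integral_random_power d (T : measurableType d)
    (nu : probability nat R) (P : probability T R)
    (h : finite_sample T -> \bar R) :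
  measurable_fun setT h -> (forall s, 0 <= h s)%E ->
  (\int[random_power nu P]_s h s =
   \sum_(0 <= k <oo) nu [set k] * \int[power_prob P k]_x h (existT _ k x))%E.
Proof.
move=> mh h0.
have nug k : 0 <= fine (nu [set k]) by rewrite fine_ge0.
pose m k : {measure set finite_sample T -> \bar R} :=
  mscale (NngNum (nug k)) (distribution (power_prob P k) (@sample_of_tuple T k)).
transitivity (\int[mseries m 0]_s h s)%E.
  apply: eq_measure_integral => A mA _; rewrite /= /mseries /random_power.
  apply: eq_eseriesr => k _; rewrite -[nu [set k]]fineK//.
  exact: fin_num_measure.
rewrite ge0_integral_measure_series//; apply: eq_eseriesr => k _.
rewrite ge0_integral_mscale//= fineK; last exact: fin_num_measure.
by rewrite ge0_integral_pushforward//; exact: measurable_existT.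
Qed.

(** The sample size has the same law [nu] under both hypotheses and contributes no factor: only the
    conditional densities remain. *)
Lemma has_density_random_power d (T : measurableType d)
    (nu : probability nat R) (P Q : probability T R) (z : T -> R) :
  has_density P Q z ->
  has_density (random_power nu P) (random_power nu Q) (random_power_lr z).
Proof.
move=> dz; have [mz z0 _] := dz.
have mlr : measurable_fun setT (random_power_lr z).
  apply: measurable_finite_sample => k; exact: measurable_prod_tnth.
have lr0 s : 0 <= random_power_lr z s by apply: prodr_ge0.
apply: (has_densityI mlr lr0) => h mh h0.
have mhz : measurable_fun setT (fun s => h s * (random_power_lr z s)%:E)%E.
  by apply: emeasurable_funM => //; exact/measurable_EFinP.
have hz0 s : (0 <= h s * (random_power_lr z s)%:E)%E.
  by apply: mule_ge0; [exact: h0|rewrite lee_fin].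
rewrite (ge0_integral_random_power nu Q mh h0).
rewrite (ge0_integral_random_power nu P mhz hz0).
apply: eq_eseriesr => k _; congr (_ * _)%E.
rewrite (has_density_integral (has_density_power k dz))//.
exact: (measurableT_comp mh (@measurable_existT _ T k)).
Qed.

End density_constructions.

(** * Random samples as images of the infinite product space *)

Section sample_law.
Context (R : realType).

(** The index takes countably many values, so preimages are countable unions of rectangles. *)
Lemma measurable_nat_index d1 (T1 : measurableType d1) d2 (T2 : measurableType d2)
    d (T : measurableType d) (M : T1 -> nat) (g : nat -> T2 -> T) :
  measurable_fun setT M -> (forall k, measurable_fun setT (g k)) ->
  measurable_fun setT (fun z : T1 * T2 => g (M z.1) z.2).
Proof.
move=> mM mg _ B mB; rewrite setTI.
rewrite (_ : _ @^-1` _ = \bigcup_k (M @^-1` [set k] `*` (g k @^-1` B))); last first.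
  apply/seteqP; split=> [[w x] /= Bx|[w x] [k _ /= [<-//]]].
  by exists (M w).
apply: bigcupT_measurable => k; apply: measurableX.
  by rewrite -[X in measurable X]setTI; exact: mM.
by rewrite -[X in measurable X]setTI; exact: mg.
Qed.

Section countable_power.
Context d (T : measurableType d) (P : probability T R).

Definition take_seq k (x : seq_space T) : k.-tuple T := [tuple x i | i < k].

Lemma measurable_coordinate i :
  measurable_fun setT (fun x : seq_space T => x i).
Proof.
move=> _ B mB; rewrite setTI; apply: sub_sigma_algebra.
by exists i, B.
Qed.

Lemma measurable_take_seq k : measurable_fun setT (take_seq k).
Proof.
apply/measurable_fun_tnthP => i.
rewrite (_ : _ \o _ = fun x : seq_space T => x i); last first.
  by apply/funext => x /=; rewrite tnth_mktuple.
exact: measurable_coordinate.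
Qed.

HB.instance Definition _ k :=
  isMeasurableFun.Build _ _ _ _ (@take_seq k) (@measurable_take_seq k).

Let rectangle k (B : 'I_k -> set T) := [set t : k.-tuple T | forall i, B i (tnth t i)].

Let measurable_rectangle k (B : 'I_k -> set T) : (forall i, measurable (B i)) ->
  measurable (rectangle B).
Proof.
move=> mB.
rewrite (_ : rectangle B = \bigcap_(i in setT) ((@tnth _ T ^~ i) @^-1` B i)).
  apply: fin_bigcap_measurable => [|i _]; first exact: finite_finset.
  by rewrite -[X in measurable X]setTI; exact: measurable_tnth.
by apply/seteqP; split=> t /= Bt i; [move=> _; exact: Bt|exact: Bt].
Qed.

Lemma power_prob_rectangle k (B : 'I_k -> set T) :
  (forall i, measurable (B i)) ->
  power_prob P k [set t : k.-tuple T | forall i, B i (tnth t i)] =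
  (\prod_(i < k) P (B i))%E.
Proof.
elim: k B => [|k ih] B mB.
  by rewrite big_ord0 /= diracE mem_set//= => -[].
rewrite big_ord_recl -ih//.
rewrite -(@product_measure1E _ _ _ _ _ P (power_prob P k))//; last first.
  by apply: (@measurable_rectangle _ (fun i => B (lift ord0 i))).
rewrite /= /distribution /pushforward; congr (product_probability _ _ _).
apply/seteqP; split=> [[x t] /= Bt|[x t] /= [Bx Bt] i].
  split; first exact: (Bt ord0).
  by move=> i; have := Bt (lift ord0 i); rewrite tnthS.
by have [j ->|->] := unliftP ord0 i; rewrite ?tnthS.
Qed.

(** Rectangles are stable under intersection and generate the sigma-algebra of tuples, and on them
    both measures are products. *)
Lemma countable_power_take (Pinf : probability (seq_space T) R) k
    (A : set (k.-tuple T)) : is_countable_power P Pinf -> measurable A ->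
  Pinf (take_seq k @^-1` A) = power_prob P k A.
Proof.
move=> PE mA.
pose G := [set C : set (k.-tuple T) | exists2 B : 'I_k -> set T,
  (forall i, measurable (B i)) & C = rectangle B].
apply: (@measure_unique _ _ (k.-tuple T) G (fun=> setT) _ _ _ _
  (distribution Pinf (@take_seq k)) (power_prob P k)) => //.
- rewrite eqEsubset; split=> A'.
    apply: smallest_sub; first exact: smallest_sigma_algebra.
    rewrite -bigcup_seq => C [i _ [B mB <-]]; apply: sub_sigma_algebra.
    exists (fun j => if j == i then B else setT); first by move=> j; case: ifP.
    apply/seteqP; split=> t /=.
      by move=> [_ Bt] j; case: eqP => // ->.
    by move=> /(_ i); rewrite eqxx.
  apply: smallest_sub; first exact: sigma_algebra_measurable.
  by move=> _ [B mB ->]; exact: measurable_rectangle.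
- move=> _ _ [B mB ->] [B' mB' ->]; exists (fun i => B i `&` B' i).
    by move=> i; exact: measurableI.
  apply/seteqP; split=> t /=; first by move=> [h h'] i.
  by move=> h; split=> i; have [] := h i.
- move=> _; exists (fun=> setT) => //.
  by apply/seteqP; split.
- by rewrite bigcup_const//; exists 0%N.
- move=> _ [B mB ->]; transitivity (\prod_(i < k) P (B i))%E; last first.
    by apply/esym; exact: power_prob_rectangle.
  rewrite -PE//; change (Pinf (take_seq k @^-1` rectangle B) =
    Pinf [set x | forall i : 'I_k, B i (x i)]).
  congr (Pinf _); apply/seteqP; split=> x /= Bx i.
    by have := Bx i; rewrite tnth_mktuple.
  by rewrite tnth_mktuple.
- by move=> _; rewrite -ge0_fin_numE//; exact: fin_num_measure.
Qed.

End countable_power.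

Section random_sample.
Context d (T : measurableType d) (P : probability T R).
Context d' (Om' : measurableType d') (P' : probability Om' R).
Variables (Pinf : probability (seq_space T) R) (N : {RV P' >-> nat}).
Hypothesis PE : is_countable_power P Pinf.

(** Realises the observed experiment on the product space where the convergence in law takes
    place. *)
Definition random_sample (z : Om' * seq_space T) : finite_sample T :=
  sample_of_tuple (take_seq (N z.1) z.2).

Lemma measurable_random_sample : measurable_fun setT random_sample.
Proof.
apply: (@measurable_nat_index _ _ _ _ _ _ N
  (fun k x => sample_of_tuple (take_seq k x))) => //.
by move=> k; exact: measurableT_comp.
Qed.

HB.instance Definition _ :=
  isMeasurableFun.Build _ _ _ _ random_sample measurable_random_sample.

Lemma random_power_law A : measurable A ->
  random_power (distribution P' N) P A =
  distribution (product_probability P' Pinf) random_sample A.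
Proof.
move=> mA; rewrite /= /random_power /distribution /pushforward.
rewrite (_ : _ @^-1` _ = \bigcup_k (N @^-1` [set k] `*`
    (take_seq k @^-1` [set x | A (existT _ k x)]))); last first.
  apply/seteqP; split=> [[w x] /= Bx|[w x] [k _ /= [<-//]]].
  by exists (N w).
have mA' k : measurable (take_seq k @^-1` [set x | A (existT _ k x)]).
  by rewrite -[X in measurable X]setTI; apply: measurable_take_seq => //; exact: mA.
have mN k : measurable (N @^-1` [set k]).
  by rewrite -[X in measurable X]setTI; exact: measurable_funP.
rewrite measure_semi_bigcup; last 3 first.
- by move=> k; exact: measurableX.
- apply/trivIsetP => i j _ _ ij; apply/seteqP; split=> // -[w x] [[/= + _] [+ _]].
  by move=> -> /eqP; rewrite (negbTE ij).
- by apply: bigcupT_measurable => k; exact: measurableX.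
apply: eq_eseriesr => k _; rewrite [RHS]product_measure1E//.
congr (_ * _)%E; apply/esym; apply: (countable_power_take PE).
exact: (mA k).
Qed.

Lemma ge0_integral_random_sample (h : finite_sample T -> \bar R) :
  measurable_fun setT h -> (forall s, 0 <= h s)%E ->
  (\int[random_power (distribution P' N) P]_s h s =
   \int[product_probability P' Pinf]_z h (random_sample z))%E.
Proof.
move=> mh h0.
rewrite -[RHS](@ge0_integral_pushforward _ _ _ _ _ _ _ _ setT)//.
by apply: eq_measure_integral => A mA _; exact: random_power_law.
Qed.

End random_sample.

End sample_law.

(** * The Skorokhod topology and Levy processes *)

Section ereal_test_functions.
Context (R : realType).

Lemma ereal_continuous_measurable (h : \bar R -> R) :
  continuous h -> measurable_fun setT h.
Proof.
move=> ch; have mhE : measurable_fun setT (h \o EFin).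
  by apply: continuous_measurable_fun => x; exact: (ch x%:E).
move=> _ B mB; rewrite setTI.
(* A measurable set of [\bar R] consists of a measurable set of reals and a subset of the two
   infinities. *)
exists ((h \o EFin) @^-1` B).
  by rewrite -[X in _ X]setTI; exact: mhE.
exists ([set -oo; +oo]%E `&` h @^-1` B).
  by apply/ps_inftyP; exact: subIsetl.
apply/seteqP; split => [_ [[x Bx <-//]|[_ Bx//]]|[x| |] /= Bx].
- by left; exists x.
- by right; split => //; right.
- by right; split => //; left.
Qed.

(** [\bar R] is the image of the compact [[-1, 1]] under [expand], so continuity is uniform for the
    metric pulled back by [contract]. Skorokhod balls compare whole paths and require this
    uniformity. *)
Lemma ereal_unif_continuous (h : \bar R -> R) (e : R) :
  continuous h -> 0 < e ->
  exists2 r : R, 0 < r & forall x y, ball x r y -> `|h x - h y| < e.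
Proof.
move=> ch e0.
have /compact_near_coveringP cpt := @segment_compact R (-1) 1.
have := @cpt R (0^'+) (fun r c => `|c| <= 1 ->
  forall y : \bar R, ball (expand c) r y -> `|h (expand c) - h y| < e) _.
case=> [c|r /= r0 rP].
  rewrite /= in_itv/= -ler_norml => c1.
  have e20 : 0 < e / 2 by rewrite divr_gt0.
  have /cvgrPdist_lt/(_ _ e20)/nbhs_ballP[r /= r0 rP] := ch (expand c).
  have Ec : contract (expand c) = c by exact: expandK.
  near=> c' r' => /= c'1 y yc'.
  have Ec' : contract (expand c') = c' by exact: expandK.
  have cc' : `|c - c'| < r / 2.
    near: c'; apply: (@cvgr_dist_lt _ _ _ _ _ id) => //.
    by rewrite divr_gt0.
  have r'r : r' < r / 2.
    by near: r'; apply: nbhs_right_lt; rewrite divr_gt0.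
  have yc'' : `|c' - contract y| < r' by rewrite -[X in `|X - _|]Ec'.
  have h1 : `|h (expand c) - h (expand c')| < e / 2.
    apply: rP; rewrite /ball/= /ereal_ball Ec Ec'.
    by apply: lt_le_trans cc' _; lra.
  have h2 : `|h (expand c) - h y| < e / 2.
    apply: rP; rewrite /ball/= /ereal_ball Ec.
    have := ler_distD c' c (contract y); lra.
  have := ler_distD (h (expand c)) (h (expand c')) (h y).
  rewrite (distrC (h (expand c')) (h (expand c))); lra.
exists (r / 2); first by rewrite divr_gt0.
move=> x y xy.
have := rP (r / 2); rewrite /= sub0r normrN ger0_norm ?divr_ge0 ?ltW//.
have -> : r / 2 < r by rewrite ltr_pdivrMr// ltr_pMr// ltr1n.
have r20 : 0 < r / 2 by rewrite divr_gt0.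
move=> /(_ isT r20 (contract x)); rewrite contractK; apply => //.
  by rewrite /= in_itv/= -ler_norml contract_le1.
exact: contract_le1.
Unshelve. all: by end_near. Qed.

Definition min_exp (c : R) (y : \bar R) : R := fine (mine (expeR y) c%:E).

Lemma min_exp_EFin c r : min_exp c r%:E = Num.min (expR r) c.
Proof. by rewrite /min_exp /= -EFin_min. Qed.

Lemma min_exp_pinfty c : min_exp c +oo = c.
Proof.
by rewrite /min_exp (_ : mine _ _ = c%:E)//; apply/min_idPr; rewrite leey.
Qed.

Lemma min_exp_ninfty c : 0 <= c -> min_exp c -oo = 0.
Proof.
move=> c0; rewrite /min_exp (_ : mine _ _ = 0%:E)//.
by apply/min_idPl; rewrite lee_fin.
Qed.

Lemma min_exp_bounds c y : 0 <= c -> 0 <= min_exp c y <= c.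
Proof.
move=> c0; case: y => [r| |].
- by rewrite min_exp_EFin le_min expR_ge0 c0/= ge_min lexx orbT.
- by rewrite min_exp_pinfty c0 lexx.
- by rewrite min_exp_ninfty// lexx c0.
Qed.

Lemma continuous_min_exp c : 0 <= c -> continuous (min_exp c).
Proof.
move=> c0 [r| |].
- have : {for r, continuous (fun x => Num.min (expR x) c)}.
    apply: (@continuous_min _ _ expR (cst c)); first exact: continuous_expR.
    exact: cst_continuous.
  move=> /cvgrPdist_lt cr; apply/cvgrPdist_lt => e e0.
  apply/nbhs_EFin; apply: filterS (cr e e0) => x.
  by rewrite !min_exp_EFin.
- apply/(@cvgrPdist_lt _ _ _ _ (nbhs_filter (+oo%E : \bar R))) => e e0.
  apply/nbhs_ereal_pinfty; split.
    by rewrite subrr normr0.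
  exists c; split; first exact: num_real.
  move=> x cx; rewrite min_exp_EFin min_exp_pinfty.
  rewrite min_r ?subrr ?normr0//; apply/ltW/(lt_le_trans cx).
  by apply: le_trans (expR_ge1Dx x); rewrite lerDr.
- apply/(@cvgrPdist_lt _ _ _ _ (nbhs_filter (-oo%E : \bar R))) => e e0.
  apply/nbhs_ereal_ninfty; split.
    by rewrite subrr normr0.
  exists (ln e); split; first exact: num_real.
  move=> x xe; rewrite min_exp_EFin min_exp_ninfty// sub0r normrN.
  rewrite ger0_norm ?le_min ?expR_ge0//.
  by rewrite gt_min -[X in _ < X]lnK// ltr_expR xe.
Qed.

End ereal_test_functions.

(** * The log-likelihood ratio as an extended real *)

Section log_likelihood_ratio.
Context (R : realType) (f : R -> R).

Lemma log_lrE k x :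
  log_lr f k x = (\sum_(i < k) lne (canonical_lr f (x i))%:E)%E.
Proof. by []. Qed.

Lemma measurable_lne : measurable_fun setT (fun x : R => lne x%:E).
Proof.
apply: measurable_fun_ifT => //; first exact: measurable_fun_ler.
by apply/measurable_EFinP; exact: measurable_ln.
Qed.

Lemma measurable_log_lr k : measurable_fun setT (canonical_lr f) ->
  measurable_fun setT (log_lr f k).
Proof.
move=> mq; apply: emeasurable_sum => i.
apply: (measurableT_comp measurable_lne); apply: (measurableT_comp mq).
exact: measurable_coordinate.
Qed.

(** The conventions [log 0 = -oo] and [exp(-oo) = 0] make this exact even when a factor vanishes; no
    summand is [+oo]. *)
Lemma expeR_log_lr k x :
  expeR (log_lr f k x) = (\prod_(i < k) canonical_lr f (x i))%:E.
Proof.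
rewrite log_lrE; elim: (index_enum _) => [|i s ih].
  by rewrite !big_nil expeR0.
rewrite !big_cons expeRD ih EFinM; congr (_ * _)%E.
by rewrite lneK// in_itv/= leey lee_fin normr_ge0.
Qed.

Lemma min_exp_log_lr c k x :
  min_exp c (log_lr f k x) = Num.min (\prod_(i < k) canonical_lr f (x i)) c.
Proof. by rewrite /min_exp expeR_log_lr -EFin_min. Qed.

End log_likelihood_ratio.

(** * A Skorokhod-continuous substitute for evaluation at a time *)

Section skorokhod_functional.
Context (R : realType).

Lemma skorokhod_continuous (T : pseudoMetricType R) (H : skorokhod R T -> R) :
  (forall x e, 0 < e -> exists m r, 0 < r /\
    forall y, skorokhod_ball x m r y -> `|H x - H y| < e) ->
  continuous H.
Proof.
move=> Hball; apply/continuousP => A oA.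
change (skorokhod_open (H @^-1` A)) => x /= Ax.
have /nbhs_ballP[e /= e0 eA] := open_nbhs_nbhs (conj oA Ax).
have [m [r [r0 rP]]] := Hball x e e0.
by exists m, r; split => // y /rP h; exact: eA.
Qed.

(** A trapezoid around [t]: 1 within distance [r], 0 from distance [2 * r] on. *)
Definition bump (t r s : R) := Num.max 0 (Num.min 1 (2 - `|s - t| / r)).

Lemma bump_bounds t r s : 0 <= bump t r s <= 1.
Proof. by rewrite /bump le_max lexx/= ge_max ler01/= ge_min lexx. Qed.

Lemma bump1 t r s : 0 < r -> `|s - t| <= r -> bump t r s = 1.
Proof.
move=> r0 sr; rewrite /bump (_ : Num.min _ _ = 1).
  by apply/max_idPr.
have h1 : `|s - t| / r <= 1 by rewrite ler_pdivrMr// mul1r.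
by apply/min_idPl; lra.
Qed.

Lemma bump0 t r s : 0 < r -> 2 * r <= `|s - t| -> bump t r s = 0.
Proof.
move=> r0 sr; apply/max_idPl; rewrite ge_min; apply/orP; right.
have h2 : 2 <= `|s - t| / r by rewrite ler_pdivlMr.
by lra.
Qed.

Lemma bump_lipschitz t r s s' : 0 < r ->
  `|bump t r s - bump t r s'| <= `|s - s'| / r.
Proof.
move=> r0; rewrite /bump; set a := 2 - `|s - t| / r; set b := 2 - `|s' - t| / r.
have ab : `|a - b| <= `|s - s'| / r.
  rewrite /a /b; have -> : 2 - `|s - t| / r - (2 - `|s' - t| / r) =
    (`|s' - t| - `|s - t|) / r by field; rewrite gt_eqF.
  rewrite normrM (gtr0_norm (x := r^-1)) ?invr_gt0//.
  apply: ler_wpM2r; first by rewrite invr_ge0 ltW.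
  have := ler_dist_dist (s' - t) (s - t).
  by rewrite (_ : s' - t - (s - t) = - (s - s')) ?normrN//; ring.
apply: le_trans ab.
have := ler_norm (a - b); have := lerNnormlW (lexx `|a - b|).
by case: (leP 1 a) => ?; case: (leP 1 b) => ?; rewrite ?(max_r ler01);
  case: (leP 0 a) => ?; case: (leP 0 b) => ? *; rewrite ler_norml; apply/andP;
  split; lra.
Qed.

Lemma continuous_bump t r : 0 < r -> continuous (bump t r).
Proof.
move=> r0 s; apply/cvgrPdist_le => e e0; near=> s'.
apply: le_trans (bump_lipschitz _ _ _ r0) _.
rewrite ler_pdivrMr//; near: s'.
by apply: (@cvgr_dist_le _ _ _ _ _ id) => //; exact: mulr_gt0.
Unshelve. all: by end_near. Qed.

Section local_sup.
Variables (h : \bar R -> R) (M t r : R).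
Hypotheses (ch : continuous h) (h0 : forall y, 0 <= h y <= M) (r0 : 0 < r).

(* Unlike evaluation at [t], this functional is continuous for the Skorokhod
   topology, since a time change moves the bump by little. *)
Definition local_sup (x : skorokhod R (\bar R)) : R :=
  sup [set bump t r s * h (x s) | s in [set s | 0 <= s]].

Let M0 : 0 <= M. Proof. by have /andP[/le_trans] := h0 0%E; apply. Qed.

Let val_bounds (x : skorokhod R (\bar R)) s : 0 <= bump t r s * h (x s) <= M.
Proof.
have /andP[b0 b1] := bump_bounds t r s; have /andP[hx0 hxM] := h0 (x s).
by rewrite mulr_ge0//= (le_trans _ hxM)// ler_piMl.
Qed.

Let vals_neq0 (x : skorokhod R (\bar R)) :
  [set bump t r s * h (x s) | s in [set s | 0 <= s]] !=set0.
Proof. by exists (bump t r 0 * h (x 0)), 0 => //=. Qed.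

Let vals_ubound (x : skorokhod R (\bar R)) :
  has_ubound [set bump t r s * h (x s) | s in [set s | 0 <= s]].
Proof. by exists M => _ [s _ <-]; case/andP: (val_bounds x s). Qed.

Lemma local_sup_ge (x : skorokhod R (\bar R)) (s : R) : 0 <= s ->
  bump t r s * h (x s) <= local_sup x.
Proof. by move=> s0; apply: ub_le_sup => //; exists s. Qed.

Lemma local_sup_le (x : skorokhod R (\bar R)) (c : R) :
  (forall s : R, 0 <= s -> bump t r s * h (x s) <= c) ->
  local_sup x <= c.
Proof. by move=> xc; apply: ge_sup => // _ [s /= s0 <-]; exact: xc. Qed.

Lemma local_sup_bounds x : 0 <= local_sup x <= M.
Proof.
apply/andP; split.
  by apply: le_trans (local_sup_ge x (lexx 0)); case/andP: (val_bounds x 0).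
by apply: local_sup_le => s _; case/andP: (val_bounds x s).
Qed.

Lemma local_sup_ge_near (x : skorokhod R (\bar R)) (s : R) :
  0 <= s -> `|s - t| <= r -> h (x s) <= local_sup x.
Proof.
by move=> s0 st; apply: le_trans (local_sup_ge x s0); rewrite bump1// mul1r.
Qed.

Lemma continuous_local_sup : continuous local_sup.
Proof.
apply: skorokhod_continuous => x e e0.
have e20 : 0 < e / 4 by rewrite divr_gt0.
have [a a0 aP] := ereal_unif_continuous ch e20.
have M10 : 0 < M + 1 by rewrite ltr_wpDl.
(* The bump is [1/r]-Lipschitz, so a shift below [b] changes a product with values of [h] by at most
   [e / 4]; [M + 1] avoids dividing by 0. *)
pose b := r * (e / 4) / (M + 1).
have b0 : 0 < b by rewrite divr_gt0// mulr_gt0.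
(* The bump vanishes beyond [|t| + 2 * r]. The extra 1 absorbs the time change, whose displacement
   the radius keeps below 1. *)
exists (`|t| + 2 * r + 1), (Num.min 1 (Num.min a b)).
split; first by rewrite !lt_min ltr01 a0.
move=> y [lam [[[lam0 lam_inj lam_surj] lam_inc] lamP]].
have close s : 0 <= s <= `|t| + 2 * r + 1 ->
    `|bump t r (lam s) * h (y (lam s)) - bump t r s * h (x s)| <= e / 2.
  move=> /lamP[]; rewrite lt_min => /andP[l1]; rewrite lt_min => /andP[la lb] xy.
  have hxy : `|h (x s) - h (y (lam s))| < e / 4.
    by apply: aP; apply: le_ball xy; rewrite ge_min; apply/orP; right; rewrite ge_min lexx.
  have bxy : `|bump t r (lam s) - bump t r s| * (M + 1) <= e / 4.
    rewrite -ler_pdivlMr//; apply: le_trans (bump_lipschitz _ _ _ r0) _.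
    rewrite ler_pdivrMr//; apply: le_trans (ltW lb) _.
    by rewrite /b mulrC mulrA mulrC -!mulrA.
  have -> : bump t r (lam s) * h (y (lam s)) - bump t r s * h (x s) =
    (bump t r (lam s) - bump t r s) * h (y (lam s)) -
    bump t r s * (h (x s) - h (y (lam s))) by ring.
  apply: le_trans (ler_normB _ _) _; rewrite !normrM.
  have /andP[hy0 hyM] := h0 (y (lam s)); have /andP[bs0 bs1] := bump_bounds t r s.
  rewrite (ger0_norm hy0) (ger0_norm bs0).
  have : `|bump t r (lam s) - bump t r s| * h (y (lam s)) <= e / 4.
    by apply: le_trans bxy; rewrite ler_wpM2l//; lra.
  have : bump t r s * `|h (x s) - h (y (lam s))| <= e / 4.
    by apply: le_trans (ltW hxy); rewrite ler_piMl.
  lra.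
have far_x s : `|t| + 2 * r + 1 < s -> bump t r s = 0.
  move=> sm; apply: bump0 => //; have := ler_norm (s - t); have := ler_norm t.
  lra.
(* Beyond the window the displacement of [lam] is not controlled, but [lam] is increasing and moves
   the right end of the window by less than 1. *)
have far_y s : `|t| + 2 * r + 1 < s -> bump t r (lam s) = 0.
  move=> sm; apply: bump0 => //; have := ler_norm (lam s - t); have := ler_norm t.
  have m0 : 0 <= `|t| + 2 * r + 1 by rewrite !addr_ge0// mulr_ge0// ltW.
  have lt1 := lam_inc _ _ m0 sm.
  have [] := lamP (`|t| + 2 * r + 1); first by rewrite m0 lexx.
  rewrite lt_min => /andP[+ _] _; rewrite ltr_norml => /andP[? _].
  lra.
have le1 : local_sup x <= local_sup y + e / 2.
  apply: local_sup_le => s s0; have [sm|sm] := leP s (`|t| + 2 * r + 1).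
    have := close s; rewrite s0 sm => /(_ isT); rewrite ler_norml => /andP[h1 _].
    have := local_sup_ge y (lam0 _ s0); lra.
  rewrite far_x// mul0r; have /andP[+ _] := local_sup_bounds y; lra.
have le2 : local_sup y <= local_sup x + e / 2.
  (* Surjectivity of the time change reaches every time of [y]. *)
  apply: local_sup_le => s' s'0; have [s s0 <-] := lam_surj s' s'0.
  have [sm|sm] := leP s (`|t| + 2 * r + 1).
    have := close s; rewrite s0 sm => /(_ isT); rewrite ler_norml => /andP[_ h1].
    have := local_sup_ge x s0; lra.
  rewrite far_y// mul0r; have /andP[+ _] := local_sup_bounds x; lra.
by rewrite ltr_norml; apply/andP; split; lra.
Qed.

(** An enumeration of the nonnegative rationals. *)
Let q (k : nat) : R := `|ratr (odflt 0 (unpickle k : option rat))|.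

(** By right continuity a countable dense set of times suffices, which makes the supremum
    measurable. *)
Let local_supE (x : skorokhod R (\bar R)) :
  local_sup x = sups (fun k => bump t r (q k) * h (x (q k))) 0.
Proof.
set v := fun s => bump t r s * h (x s).
have ub : has_ubound (sdrop (v \o q) 0).
  by exists M => _ [k _ <-]; case/andP: (val_bounds x (q k)).
apply/eqP; rewrite eq_le; apply/andP; split; last first.
  apply: ge_sup; first by exists (v (q 0%N)), 0%N.
  by move=> _ [k _ <-]; apply: local_sup_ge; exact: normr_ge0.
apply: local_sup_le => s s0; apply/ler_addgt0Pr => e e0.
have vs : v s' @[s' --> s^'+] --> v s.
  apply: cvgM.
    by apply: cvg_at_right_filter; exact: continuous_bump.
  have xs : x s' @[s' --> s^'+] --> x s.
    by case: (cadlag_path_of x) => + _; exact.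
  by move=> A /(@ch (x s)); exact: xs.
have /cvgrPdist_le/(_ _ e0) := vs.
move=> [b /= b0 bP].
have sb : s < s + b by rewrite ltrDl.
have [p] := rat_in_itvoo sb; rewrite in_itv/= => /andP[sp pb].
rewrite -[leLHS]/(v s) -[leLHS](subrK (v (ratr p))) addrC; apply: lerD.
  apply: ub_le_sup => //; exists (pickle p) => //=.
  by rewrite /q pickleK /= ger0_norm// ltW// (le_lt_trans s0).
apply: le_trans (ler_norm _) _; apply: bP => //=.
by rewrite ltr_norml; apply/andP; split; lra.
Qed.

Lemma measurable_local_sup d (Om : measurableType d) (X : Om -> skorokhod R (\bar R)) :
  (forall s, 0 <= s -> measurable_fun setT (fun w => X w s)) ->
  measurable_fun setT (fun w => local_sup (X w)).
Proof.
move=> mX; rewrite (_ : (fun w => _) =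
  fun w => sups (fun k => bump t r (q k) * h (X w (q k))) 0); last first.
  by apply/funext => w; exact: local_supE.
apply: measurable_fun_sups.
  by move=> w _; exists M => _ [k _ <-]; case/andP: (val_bounds (X w) (q k)).
move=> k; apply: measurable_funM => //.
apply: (measurableT_comp (ereal_continuous_measurable ch)).
by apply: mX; exact: normr_ge0.
Qed.

End local_sup.

End skorokhod_functional.

Section equality_in_law.
Context (R : realType).

Lemma ge0_integral_eq_law d1 (T1 : measurableType d1) d2 (T2 : measurableType d2)
    d (T : measurableType d) (P1 : probability T1 R) (P2 : probability T2 R)
    (X1 : T1 -> T) (X2 : T2 -> T) (g : T -> \bar R) :
  measurable_fun setT X1 -> measurable_fun setT X2 ->
  (forall B, measurable B -> P1 (X1 @^-1` B) = P2 (X2 @^-1` B)) ->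
  measurable_fun setT g -> (forall x, 0 <= g x)%E ->
  (\int[P1]_x g (X1 x) = \int[P2]_x g (X2 x))%E.
Proof.
move=> mX1 mX2 X12 mg g0.
transitivity (\int[pushforward P1 X1]_y g y)%E.
  by rewrite ge0_integral_pushforward.
transitivity (\int[pushforward P2 X2]_y g y)%E.
  by apply: eq_measure_integral => A mA _; exact: X12.
by rewrite ge0_integral_pushforward.
Qed.

End equality_in_law.

(** * Absence of fixed jumps of a Levy process *)

Section levy_process.
Context (R : realType) d (Om : measurableType d) (P : probability Om R).
Variable L : Om -> skorokhod R R.
Hypothesis L_levy : is_levy P L.

Let mL (t : R) : 0 <= t -> measurable_fun setT (fun w => L w t).
Proof. exact: (levy_measurable L_levy). Qed.

(** A bounded measure of distance to 0, so that increments need no moments. *)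
Let gap (x : R) : R := Num.min 1 `|x|.

Let gap_bounds x : 0 <= gap x <= 1.
Proof. by rewrite /gap le_min ler01 normr_ge0 ge_min lexx. Qed.

Let continuous_gap : continuous gap.
Proof.
move=> x; apply: (@continuous_min _ _ (cst 1) (fun x => `|x|)).
  exact: cst_continuous.
exact: norm_continuous.
Qed.

Let measurable_gap : measurable_fun setT gap.
Proof. exact: continuous_measurable_fun. Qed.

Let u t (m : nat) : R := t / m.+2%:R.

Let u_cvg t : u t m @[m --> \oo] --> (0 : R).
Proof.
rewrite -[X in _ --> X](mulr0 t); apply: cvgM; first exact: cvg_cst.
by have := @cvg_harmonic R; rewrite -cvg_shiftS.
Qed.

(** By stationarity the increment just before [t] has the law of the increment just after 0, which
    is small by right continuity. *)
Let integral_gap_left (t : R) : 0 < t ->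
  (\int[P]_w (gap (L w t - L w (t - u t m)))%:E)%E @[m --> \oo] --> 0%E.
Proof.
move=> t0.
have ut m : 0 < u t m < t.
  rewrite divr_gt0//= ltr_pdivrMr// ltr_pMr// ltr1n//.
have E m : (\int[P]_w (gap (L w t - L w (t - u t m)))%:E =
            \int[P]_w (gap (L w (u t m) - L w 0))%:E)%E.
  have /andP[u0 ult] := ut m.
  apply: (@ge0_integral_eq_law _ _ _ _ _ _ _ P P
    (fun w => L w t - L w (t - u t m)) (fun w => L w (u t m) - L w 0)
    (fun x => (gap x)%:E)).
  - apply: measurable_funB; apply: mL; first exact: ltW.
    by rewrite subr_ge0 ltW.
  - by apply: measurable_funB; apply: mL => //; exact: ltW.
  - move=> B mB.
    have := levy_stationary L_levy (s := t - u t m) (h := u t m) (B := B).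
    by rewrite subrK; apply => //; rewrite ?subr_ge0 ltW.
  - exact/measurable_EFinP.
  - by move=> x; rewrite lee_fin; case/andP: (gap_bounds x).
under eq_cvg do rewrite E.
suff : (\int[P]_w (gap (L w (u t m) - L w 0))%:E)%E @[m --> \oo] -->
    (\int[P]_w (cst 0%E w))%E by rewrite integral0.
apply: (@dominated_cvg _ _ _ P setT measurableT _ _ (cst 1%E)).
- move=> m; apply/measurable_EFinP; apply: (measurableT_comp measurable_gap).
  by apply: measurable_funB; apply: mL => //; case/andP: (ut m) => /ltW.
- move=> w _; apply: cvg_EFin; first exact: nearW.
  have Lw : L w (u t m) - L w 0 @[m --> \oo] --> (0 : R).
    rewrite -[X in _ --> X](subrr (L w 0)); apply: cvgB; last exact: cvg_cst.
    have [rc _] := cadlag_path_of (L w).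
    have /cvg_at_rightP := rc 0 (lexx 0); apply; split; last exact: u_cvg.
    by move=> m; case/andP: (ut m).
  have := cvg_comp _ _ Lw (continuous_gap (x:=0)).
  by rewrite {2}/gap normr0 min_r.
- by [].
- exact: integrable_cstT.
- move=> m w _ /=; rewrite lee_fin ger0_norm; last first.
    by case/andP: (gap_bounds (L w (u t m) - L w 0)).
  by case/andP: (gap_bounds (L w (u t m) - L w 0)).
Qed.

(** Dominated convergence and [integral_gap_left] show that the gap between [L(t)] and its left
    limit has mean 0. Right continuity handles the other side, and is enough alone when [t = 0]. *)
Lemma levy_no_fixed_jump (t : R) : 0 <= t -> {ae P, forall w, forall e, 0 < e ->
  exists2 r : R, 0 < r & forall s, 0 <= s -> `|s - t| < r ->
    `|L w s - L w t| < e}.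
Proof.
have right w (t' e : R) : 0 <= t' -> 0 < e -> exists2 r : R, 0 < r &
    forall s, t' <= s -> s - t' < r -> `|L w s - L w t'| < e.
  move=> t0 e0; have [rc _] := cadlag_path_of (L w).
  have /cvgrPdist_lt/(_ _ e0)[r /= r0 rP] := rc t' t0.
  exists r => // s; rewrite le_eqVlt => /predU1P[<- _|ts sr].
    by rewrite subrr normr0.
  rewrite distrC; apply: rP => //=; rewrite distrC ger0_norm// subr_ge0.
  exact: ltW.
rewrite le_eqVlt => /predU1P[<-|t0].
  apply: aeW => w e e0; have [r r0 rP] := right w 0 e (lexx 0) e0.
  exists r => // s s0; rewrite subr0 ger0_norm// => sr.
  by apply: rP; rewrite // subr0.
pose l w := xget 0 [set y : R | L w s @[s --> t^'-] --> y].
have lP w : L w s @[s --> t^'-] --> l w.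
  have [_ ll] := cadlag_path_of (L w); have [y yP] := ll t t0.
  rewrite /l; case: xgetP => [z _ //|/(_ y)]; contradiction.
have ut m : 0 < u t m < t.
  rewrite divr_gt0//= ltr_pdivrMr// ltr_pMr// ltr1n//.
have cvg_gap w : gap (L w t - L w (t - u t m)) @[m --> \oo] --> gap (L w t - l w).
  have Lw : L w t - L w (t - u t m) @[m --> \oo] --> L w t - l w.
    apply: cvgB; first exact: cvg_cst.
    have /cvg_at_leftP := lP w; apply; split.
      by move=> m; rewrite ltrBlDr ltrDl; case/andP: (ut m).
    rewrite -[X in _ --> X]subr0; apply: cvgB; [exact: cvg_cst|exact: u_cvg].
  exact: cvg_comp _ _ Lw (@continuous_gap _).
have mgapm m : measurable_fun setT (fun w => (gap (L w t - L w (t - u t m)))%:E).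
  apply/measurable_EFinP; apply: (measurableT_comp measurable_gap).
  apply: measurable_funB; apply: mL; first exact: ltW.
  by rewrite subr_ge0 ltW//; case/andP: (ut m).
have cvg_gapE w : setT w -> (gap (L w t - L w (t - u t m)))%:E @[m --> \oo] -->
    (gap (L w t - l w))%:E.
  by move=> _; apply: cvg_EFin; [exact: nearW|exact: cvg_gap].
have : ae_eq P setT (fun w => (gap (L w t - l w))%:E) (cst 0%E).
  apply/ae_eq_integral_abs => //.
    exact: (emeasurable_fun_cvg _ _ mgapm cvg_gapE).
  have := @dominated_cvg _ _ _ P setT measurableT _ _ (cst 1%E) mgapm cvg_gapE.
  move=> /(_ _ _ _) cvg_int.
  transitivity (\int[P]_w (gap (L w t - l w))%:E)%E.
    apply: eq_integral => w _; rewrite gee0_abs// lee_fin.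
    by case/andP: (gap_bounds (L w t - l w)).
  apply: (cvg_unique _ (cvg_int _ _ _)) => //.
  - exact: integrable_cstT.
  - move=> m w _; rewrite lee_fin ger0_norm//;
    by case/andP: (gap_bounds (L w t - L w (t - u t m))).
  - exact: integral_gap_left.
apply: filterS => w /= /(_ I)[] gap0 e e0.
have Ll : l w = L w t.
  apply/eqP; rewrite eq_sym -subr_eq0 -normr_le0.
  move: gap0; rewrite /gap; case: (leP 1 `|L w t - l w|) => // _; first by lra.
  by move=> ->.
have [r1 r10 r1P] := right w t e (ltW t0) e0.
have /cvgrPdist_lt/(_ _ e0)[r2 /= r20 r2P] := lP w.
exists (Num.min r1 r2); first by rewrite lt_min r10.
move=> s s0; rewrite lt_min => /andP[s1 s2].
have [ts|st] := leP t s; first by apply: r1P => //; apply: le_lt_trans s1; exact: ler_norm.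
by rewrite distrC -Ll; apply: r2P => //=; rewrite distrC.
Qed.

End levy_process.

Section shifted_integrals.
Context (R : realType) d (T : measurableType d) (P : probability T R).

Lemma Rintegral_cstD (c : R) (g : T -> R) : P.-integrable setT (EFin \o g) ->
  \int[P]_x (c + g x) = c + \int[P]_x g x.
Proof.
by move=> ig; rewrite RintegralD ?Rintegral_cstT//; exact: integrable_cstT.
Qed.

Lemma Rintegral_cstB (c : R) (g : T -> R) : P.-integrable setT (EFin \o g) ->
  \int[P]_x (c - g x) = c - \int[P]_x g x.
Proof.
by move=> ig; rewrite RintegralB ?Rintegral_cstT//; exact: integrable_cstT.
Qed.

End shifted_integrals.

(** * Locally uniform convergence of the means at deterministic times *)

Section process_convergence.
Context (R : realType) d (Om : measurableType d) (P : probability Om R).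
Variable L : Om -> skorokhod R R.
Hypothesis L_levy : is_levy P L.
Context d1 (Om1 : measurableType d1) (P1 : probability Om1 R).
Variable G : nat -> Om1 -> skorokhod R (\bar R).
Hypothesis mG : \forall n \near \oo, forall s, 0 <= s ->
  measurable_fun setT (fun x => G n x s).
Hypothesis G_cvg : cvg_in_law P1 G P (fun w => EFin_path (L w)).

Definition mean_at (h : \bar R -> R) (n : nat) (s : R) : R :=
  \int[P1]_x h (G n x s).
Definition mean_lim (h : \bar R -> R) (s : R) : R :=
  \int[P]_w h (L w s)%:E.

Let mL (s : R) : 0 <= s -> measurable_fun setT (fun w => (L w s)%:E).
Proof. by move=> s0; apply/measurable_EFinP; exact: (levy_measurable L_levy). Qed.

Lemma integrable_test_process d2 (T2 : measurableType d2) (P2 : probability T2 R)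
    (h : \bar R -> R) M (X : T2 -> \bar R) :
  continuous h -> (forall y, `|h y| <= M) -> measurable_fun setT X ->
  P2.-integrable setT (fun x => (h (X x))%:E).
Proof.
move=> ch hM mX; apply: (@bounded_integrable _ _ _ P2 (h \o X) M) => //.
  exact: (measurableT_comp (ereal_continuous_measurable ch)).
by move=> x; exact: hM.
Qed.

(** Almost every path of [L] is continuous at [t], so its local supremum shrinks to the value of [h]
    there. *)
Let local_sup_cvg (h : \bar R -> R) (M t : R) :
  continuous h -> (forall y, 0 <= h y <= M) -> 0 <= t ->
  (\int[P]_w (local_sup h t m.+1%:R^-1 (EFin_path (L w)))%:E)%E @[m --> \oo] -->
  (\int[P]_w (h (L w t)%:E)%:E)%E.
Proof.
move=> ch h0 t0.
have m0 (m : nat) : 0 < m.+1%:R^-1 :> R by rewrite invr_gt0.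
have mf_ m : measurable_fun setT
    (fun w => (local_sup h t m.+1%:R^-1 (EFin_path (L w)))%:E).
  apply/measurable_EFinP.
  exact: (measurable_local_sup (X := fun w => EFin_path (L w)) t ch h0 (m0 m) mL).
have mf : measurable_fun setT (fun w => (h (L w t)%:E)%:E).
  apply/measurable_EFinP; apply: (measurableT_comp (ereal_continuous_measurable ch)).
  exact: mL.
have f_f : {ae P, forall w, setT w ->
    (local_sup h t m.+1%:R^-1 (EFin_path (L w)))%:E @[m --> \oo] -->
    (h (L w t)%:E)%:E}.
  apply: filterS (levy_no_fixed_jump L_levy t0) => w Lw _.
  apply: cvg_EFin; first exact: nearW.
  apply/cvgrPdist_le => e e0.
  have /cvgrPdist_le/(_ _ e0)/nbhs_EFin/nbhs_ballP[r /= r0 rP] := ch (L w t)%:E.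
  have [r' r'0 r'P] := Lw r r0.
  near=> m.
  have mr : 2 * m.+1%:R^-1 <= r'.
    near: m; exists (Num.truncn (2 / r')) => // m /= rm.
    rewrite ler_pdivrMr// mulrC -ler_pdivrMr//.
    by apply/ltW/(lt_le_trans (truncnS_gt _)); rewrite ler_nat ltnS.
  have le1 : h (L w t)%:E <= local_sup h t m.+1%:R^-1 (EFin_path (L w)).
    apply: (@local_sup_ge_near _ _ M _ _ h0 (m0 m) (EFin_path (L w)) t) => //.
    by rewrite subrr normr0 ltW.
  have le2 : local_sup h t m.+1%:R^-1 (EFin_path (L w)) <= h (L w t)%:E + e.
    apply: local_sup_le => s s0.
    have /andP[ht0 htM] := h0 (L w t)%:E; have /andP[hs0 hsM] := h0 (L w s)%:E.
    have /andP[b0 b1] := bump_bounds t m.+1%:R^-1 s.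
    have [far|near_t] := leP (2 * m.+1%:R^-1) `|s - t|.
      by rewrite bump0// mul0r addr_ge0// ltW.
    have : `|h (L w t)%:E - h (L w s)%:E| <= e.
      by apply: rP; rewrite /ball/= distrC; apply: r'P => //; exact: lt_le_trans mr.
    rewrite ler_norml => /andP[h1 _].
    apply: (@le_trans _ _ (h (L w s)%:E)); last by lra.
    by rewrite /= ler_piMl.
  by rewrite ler_norml; apply/andP; split; lra.
have f_g : {ae P, forall w m, setT w ->
    `|(local_sup h t m.+1%:R^-1 (EFin_path (L w)))%:E| <= M%:E}%E.
  apply: aeW => w m _; have := local_sup_bounds t m.+1%:R^-1 h0 (EFin_path (L w)).
  by move=> /andP[l0 lM]; rewrite lee_fin ger0_norm.
by have [] := dominated_convergence measurableT mf_ mf f_f (integrable_cstT P M) f_g.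
Unshelve. all: by end_near. Qed.

(** One functional dominates [h (x s)] for all [s] within [r] of [t] at once, hence a bound uniform
    in [s] from a single application of convergence in law. *)
Lemma mean_at_upper (h : \bar R -> R) (M t e : R) :
  continuous h -> (forall y, 0 <= h y <= M) -> 0 <= t -> 0 < e ->
  exists2 r : R, 0 < r & \forall n \near \oo, forall s, 0 <= s ->
    `|s - t| <= r -> mean_at h n s <= mean_lim h t + e.
Proof.
move=> ch h0 t0 e0.
have hM y : `|h y| <= M by have /andP[? ?] := h0 y; rewrite ger0_norm.
have e20 : 0 < e / 2 by rewrite divr_gt0.
have m0 (m : nat) : 0 < m.+1%:R^-1 :> R by rewrite invr_gt0.
have iL := integrable_test_process P ch hM (mL t0).
have := local_sup_cvg ch h0 t0.
rewrite (integral_EFin_Rintegral iL) => /fine_cvg/cvgrPdist_le/(_ _ e20)[m _].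
move=> /(_ m (leqnn m)); rewrite -/(mean_lim h t) ler_norml => /andP[supL _].
exists m.+1%:R^-1 => //.
pose H := local_sup h t m.+1%:R^-1.
have cH : continuous H by exact: (@continuous_local_sup R h M t _ ch h0 (m0 m)).
have Hb x : 0 <= H x <= M by exact: (local_sup_bounds t m.+1%:R^-1 h0).
have HM x : `|H x| <= M by have /andP[? ?] := Hb x; rewrite ger0_norm.
have := G_cvg cH (ex_intro _ M HM).
have iH d2 (T2 : measurableType d2) (P2 : probability T2 R)
    (X : T2 -> skorokhod R (\bar R)) :
    (forall s, 0 <= s -> measurable_fun setT (fun w => X w s)) ->
    P2.-integrable setT (fun w => (H (X w))%:E).
  move=> mX; apply: (@bounded_integrable _ _ _ P2 (H \o X) M) => //.
    exact: (measurable_local_sup t ch h0 (m0 m) mX).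
  by move=> x; exact: HM.
rewrite unlock (integral_EFin_Rintegral (iH _ _ P (fun w => EFin_path (L w)) mL)).
move=> /fine_cvg/cvgrPdist_le/(_ _ e20) HG.
near=> n; move=> s s0 st.
have mGn : forall s, 0 <= s -> measurable_fun setT (fun x => G n x s) by near: n.
have : mean_at h n s <= \int[P1]_x H (G n x).
  apply: le_Rintegral => //.
  - exact: integrable_test_process ch hM (mGn s s0).
  - exact: iH.
  - by move=> x _; exact: (local_sup_ge_near h0 (m0 m)).
have : `|\int[P]_w H (EFin_path (L w)) - \int[P1]_x H (G n x)| <= e / 2.
  by near: n.
rewrite ler_norml => /andP[+ _].
have supL' : - (e / 2) <= mean_lim h t - \int[P]_w H (EFin_path (L w)) by [].
lra.
Unshelve. all: by end_near. Qed.

(** The lower bound is the upper bound for [M - h]; both shifts by [M] give the nonnegative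
    functions that a local supremum requires. *)
Lemma mean_at_cvg (h : \bar R -> R) (M t e : R) :
  continuous h -> (forall y, `|h y| <= M) -> 0 <= t -> 0 < e ->
  exists2 r : R, 0 < r & \forall n \near \oo, forall s, 0 <= s ->
    `|s - t| <= r -> `|mean_at h n s - mean_lim h t| <= e.
Proof.
move=> ch hM t0 e0.
have hp y : 0 <= M + h y <= 2 * M.
  by have := hM y; rewrite ler_norml => /andP[? ?]; apply/andP; split; lra.
have hm y : 0 <= M - h y <= 2 * M.
  by have := hM y; rewrite ler_norml => /andP[? ?]; apply/andP; split; lra.
have cp : continuous (fun y => M + h y).
  by move=> y; apply: cvgD; [exact: cvg_cst|exact: ch].
have cm : continuous (fun y => M - h y).
  by move=> y; apply: cvgB; [exact: cvg_cst|exact: ch].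
have [r1 r10 P1'] := mean_at_upper cp hp t0 e0.
have [r2 r20 P2'] := mean_at_upper cm hm t0 e0.
exists (Num.min r1 r2); first by rewrite lt_min r10.
near=> n; move=> s s0; rewrite le_min => /andP[s1 s2].
have mGn : forall s, 0 <= s -> measurable_fun setT (fun x => G n x s) by near: n.
have iG := integrable_test_process P1 ch hM (mGn s s0).
have iL := integrable_test_process P ch hM (mL t0).
have up : mean_at (fun y => M + h y) n s <= mean_lim (fun y => M + h y) t + e.
  by apply: (near P1' n) => //.
have um : mean_at (fun y => M - h y) n s <= mean_lim (fun y => M - h y) t + e.
  by apply: (near P2' n) => //.
move: up um; rewrite /mean_at /mean_lim.
rewrite (Rintegral_cstD M iG) (Rintegral_cstD M iL).
rewrite (Rintegral_cstB M iG) (Rintegral_cstB M iL).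
rewrite ler_norml => h1 h2; apply/andP; split; lra.
Unshelve. all: by end_near. Qed.

(** For one large [n], the value [mean_at h n s] is close to the limits at both [s] and [t]. *)
Lemma mean_lim_continuous (h : \bar R -> R) (M t e : R) :
  continuous h -> (forall y, `|h y| <= M) -> 0 <= t -> 0 < e ->
  exists2 r : R, 0 < r & forall s, 0 <= s -> `|s - t| <= r ->
    `|mean_lim h s - mean_lim h t| <= e.
Proof.
move=> ch hM t0 e0; have e20 : 0 < e / 2 by rewrite divr_gt0.
have [r r0 rP] := mean_at_cvg ch hM t0 e20.
exists r => // s s0 st.
have [r' r'0 r'P] := mean_at_cvg ch hM s0 e20.
have [n [n1 n2]] : exists n, (forall s', 0 <= s' -> `|s' - t| <= r ->
    `|mean_at h n s' - mean_lim h t| <= e / 2) /\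
    (forall s', 0 <= s' -> `|s' - s| <= r' ->
    `|mean_at h n s' - mean_lim h s| <= e / 2).
  have [n [h1 h2]] := filter_ex (filterI rP r'P).
  by exists n.
have := n1 s s0 st; have := n2 s s0; rewrite subrr normr0 (ltW r'0) => /(_ isT).
rewrite !ler_norml => /andP[? ?] /andP[? ?]; apply/andP; split; lra.
Qed.

Lemma mean_at_cvg_unif (h : \bar R -> R) (M K e : R) :
  continuous h -> (forall y, `|h y| <= M) -> 0 < e ->
  \forall n \near \oo, forall s, 0 <= s <= K ->
    `|mean_at h n s - mean_lim h s| <= e.
Proof.
move=> ch hM e0; have e20 : 0 < e / 2 by rewrite divr_gt0.
have /compact_near_coveringP cpt := @segment_compact R 0 K.
have := @cpt nat \oo (fun n s => 0 <= s ->
    `|mean_at h n s - mean_lim h s| <= e) _.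
case=> [s|n _ nP]; last first.
  exists n => // m /nP mP s /andP[s0 sK].
  by apply: mP => //=; rewrite in_itv/= s0.
rewrite /= in_itv/= => /andP[s0 _].
have [r r0 rP] := mean_at_cvg ch hM s0 e20.
have [r' r'0 r'P] := mean_lim_continuous ch hM s0 e20.
near=> s' n => /= s'0.
have h1 : `|mean_at h n s' - mean_lim h s| <= e / 2.
  have ss' : `|s' - s| <= r.
    by near: s'; apply: (@cvgr_distC_le _ _ _ _ _ id).
  by apply: (near rP n) => //.
have h2 : `|mean_lim h s' - mean_lim h s| <= e / 2.
  apply: r'P => //; near: s'; exact: (@cvgr_distC_le _ _ _ _ _ id).
move: h1 h2; rewrite !ler_norml => /andP[? ?] /andP[? ?]; apply/andP; split; lra.
Unshelve. all: by end_near. Qed.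

End process_convergence.

(** * Random times *)

Section random_time.
Context (R : realType) d (Om : measurableType d) (P : probability Om R).

(** Under [P] restricted to [A], the image of [X] is [P A] times its law. *)
Lemma ge0_integral_indep (X : Om -> R) (A : set Om) (g : R -> \bar R) :
  measurable_fun setT X -> measurable A -> measurable_fun setT g ->
  (forall x, 0 <= g x)%E ->
  (forall B, measurable B -> P (X @^-1` B `&` A) = (P (X @^-1` B) * P A)%E) ->
  (\int[P]_(w in A) g (X w) = P A * \int[P]_w g (X w))%E.
Proof.
move=> mX mA mg g0 XA.
have mgX : measurable_fun setT (g \o X) by exact: measurableT_comp.
transitivity (\int[mrestr P mA]_(w in A) g (X w))%E.
  by apply/esym/eq_measure_integral => B mB BA; rewrite /= /mrestr setIidl.
transitivity (\int[mrestr P mA]_w g (X w))%E.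
  rewrite [RHS](@ge0_negligible_integral _ _ _ (mrestr P mA) setT (~` A))//.
  - by rewrite setTD setCK.
  - exact: measurableC.
  - by rewrite /= /mrestr setICl measure0.
transitivity (\int[pushforward (mrestr P mA) X]_x g x)%E.
  by rewrite ge0_integral_pushforward.
have PA0 : 0 <= fine (P A) by rewrite fine_ge0.
pose X' : {mfun Om >-> R} :=
  HB.pack_for {mfun Om >-> R} X (isMeasurableFun.Build _ _ Om R X mX).
transitivity (\int[mscale (NngNum PA0) (distribution P X')]_x g x)%E.
  apply: eq_measure_integral => B mB _.
  transitivity (P (X @^-1` B `&` A)) => //.
  rewrite XA// muleC; transitivity ((fine (P A))%:E * P (X @^-1` B))%E => //.
  by rewrite fineK// fin_num_measure.
rewrite ge0_integral_mscale//= fineK ?fin_num_measure//.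
by rewrite ge0_integral_pushforward.
Qed.

Variable L : Om -> skorokhod R R.
Hypothesis L_levy : is_levy P L.
Variable tau : {RV P >-> R}.
Hypothesis tau_ge0 : forall w, 0 <= tau w.
Hypothesis tau_indep : indep_process P L tau.

Let mL (s : R) : 0 <= s -> measurable_fun setT (fun w => L w s).
Proof. exact: (levy_measurable L_levy). Qed.

Let mLE (t : R) : 0 <= t -> measurable_fun setT (fun w => (L w t)%:E).
Proof. by move=> t0; apply/measurable_EFinP; exact: mL. Qed.

Lemma mean_lim_bounds (h : \bar R -> R) (M t : R) :
  continuous h -> (forall y, 0 <= h y <= M) -> 0 <= t ->
  0 <= mean_lim P L h t <= M.
Proof.
move=> ch h0 t0.
have hM y : `|h y| <= M by have /andP[? ?] := h0 y; rewrite ger0_norm.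
rewrite Rintegral_ge0/=; last by move=> w _; case/andP: (h0 (L w t)%:E).
rewrite -[leRHS](Rintegral_cstT P); apply: le_Rintegral => //.
- exact: (integrable_test_process P ch hM (mLE t0)).
- exact: integrable_cstT.
- by move=> w _; case/andP: (h0 (L w t)%:E).
Qed.

(** Absence of a fixed jump at [t] plus dominated convergence. The argument involves [L] alone,
    whereas [mean_lim_continuous] goes through approximating processes. *)
Lemma mean_lim_cvg (h : \bar R -> R) (M t : R) (u : R^nat) :
  continuous h -> (forall y, 0 <= h y <= M) -> (forall n, 0 <= u n) -> 0 <= t ->
  u n @[n --> \oo] --> t ->
  mean_lim P L h (u n) @[n --> \oo] --> mean_lim P L h t.
Proof.
move=> ch h0 u0 t0 ut.
have hM y : `|h y| <= M by have /andP[? ?] := h0 y; rewrite ger0_norm.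
have mhE : measurable_fun setT (h \o EFin).
  by apply: continuous_measurable_fun => x; exact: (ch x%:E).
have mfn n : measurable_fun setT (fun w => (h (L w (u n))%:E)%:E).
  by apply/measurable_EFinP; apply: (measurableT_comp mhE); exact: mL.
have mf : measurable_fun setT (fun w => (h (L w t)%:E)%:E).
  by apply/measurable_EFinP; apply: (measurableT_comp mhE); exact: mL.
have fnf : {ae P, forall w, setT w ->
    (h (L w (u n))%:E)%:E @[n --> \oo] --> (h (L w t)%:E)%:E}.
  apply: filterS (levy_no_fixed_jump L_levy t0) => w Lw _.
  apply: cvg_EFin; first exact: nearW.
  have Lu : L w (u n) @[n --> \oo] --> L w t.
    apply/cvgrPdist_lt => e e0; have [r r0 rP] := Lw e e0.
    move/cvgrPdist_lt : ut => /(_ r r0); apply: filterS => n tn.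
    by rewrite distrC; apply: rP => //; rewrite distrC.
  by move=> A /(ch (L w t)%:E); exact: Lu.
have fnM : {ae P, forall w n, setT w -> `|(h (L w (u n))%:E)%:E| <= M%:E}%E.
  by apply: aeW => w n _; rewrite lee_fin hM.
have [_ _ cv] := dominated_convergence measurableT mfn mf fnf (integrable_cstT P M) fnM.
apply: fine_cvg; rewrite fineK//.
by apply: integrable_fin_num => //; exact: (integrable_test_process P ch hM (mLE t0)).
Qed.

(** Index of the first grid point strictly after [tau]: the strict approach from the right is the
    one along which paths converge. *)
Let K (m : nat) (w : Om) : nat := (Num.truncn (tau w * m.+1%:R)).+1.
Let s (m k : nat) : R := k%:R / m.+1%:R.

Let s0 m k : 0 <= s m k. Proof. by rewrite divr_ge0. Qed.

Let preimage_K m k : K m @^-1` [set k.+1] =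
  tau @^-1` `[k%:R / m.+1%:R, k.+1%:R / m.+1%:R[.
Proof.
apply/seteqP; split=> w; rewrite /= in_itv/= ler_pdivrMr// ltr_pdivlMr//.
  by move=> [<-]; rewrite truncn_le truncnS_gt mulr_ge0.
by move=> h; rewrite /K (truncn_def h).
Qed.

Let measurable_K m k : measurable (K m @^-1` [set k]).
Proof.
case: k => [|k].
  by rewrite (_ : _ @^-1` _ = set0)//; apply/seteqP; split.
by rewrite preimage_K -[X in measurable X]setTI; exact: measurable_funP.
Qed.

Let K_cover m : setT = \bigcup_k (K m @^-1` [set k]).
Proof. by apply/seteqP; split=> // w _; exists (K m w). Qed.

Let K_triv m : trivIset setT (fun k => K m @^-1` [set k]).
Proof.
apply/trivIsetP => i j _ _ ij; apply/seteqP; split=> // w [/= -> /eqP].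
by rewrite (negbTE ij).
Qed.

Let tau_gt m w : tau w < s m (K m w).
Proof. by rewrite /s ltr_pdivlMr// truncnS_gt. Qed.

Let tau_close m w : s m (K m w) <= tau w + m.+1%:R^-1.
Proof.
rewrite /s ler_pdivrMr// mulrDl mulVf// /K -natr1 lerD2r.
by rewrite truncn_le mulr_ge0.
Qed.

Let s_cvg w : s m (K m w) @[m --> \oo] --> tau w.
Proof.
have t1 : tau w + m.+1%:R^-1 @[m --> \oo] --> tau w.
  rewrite -[X in _ --> X]addr0; apply: cvgD; first exact: cvg_cst.
  exact: cvg_harmonic.
apply: (@squeeze_cvgr _ _ _ _ (fun=> tau w) (fun m => tau w + m.+1%:R^-1)) => //.
  by near=> m; rewrite tau_close ltW.
exact: cvg_cst.
Unshelve. all: by end_near. Qed.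

Let L_cvg w : L w (s m (K m w)) @[m --> \oo] --> L w (tau w).
Proof.
have [rc _] := cadlag_path_of (L w).
by have /cvg_at_rightP := rc (tau w) (tau_ge0 w); apply.
Qed.

Let measurable_discrete d2 (T2 : measurableType d2) m (g : nat -> Om -> T2) :
  (forall k, measurable_fun setT (g k)) ->
  measurable_fun setT (fun w => g (K m w) w).
Proof.
move=> mg _ B mB; rewrite setTI.
rewrite (_ : _ @^-1` _ = \bigcup_k (K m @^-1` [set k] `&` g k @^-1` B)); last first.
  apply/seteqP; split=> [w Bw|w [k _ [<-//]]].
  by exists (K m w).
apply: bigcupT_measurable => k; apply: measurableI => //.
by rewrite -[X in measurable X]setTI; exact: mg.
Qed.

Lemma measurable_levy_random_time : measurable_fun setT (fun w => L w (tau w)).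
Proof.
apply: (@measurable_fun_cvg _ _ _ _ (fun m w => L w (s m (K m w)))) => //.
move=> m; apply: (@measurable_discrete _ _ m (fun k w => L w (s m k))).
by move=> k; exact: mL.
Qed.

Let integral_split m (f : Om -> \bar R) : measurable_fun setT f ->
  (forall w, 0 <= f w)%E ->
  (\int[P]_w f w = \sum_(0 <= k <oo) \int[P]_(w in K m @^-1` [set k]) f w)%E.
Proof.
move=> mf f0; rewrite {1}(K_cover m) ge0_integral_bigcup//.
by rewrite -K_cover.
Qed.

(** On each event [K m = k] the time is deterministic and the event depends on [tau] alone, so
    independence applies. *)
Let ge0_integral_discrete (g : R -> R) m : measurable_fun setT g ->
  (forall x, 0 <= g x) ->
  (forall t, 0 <= t -> (\int[P]_w (g (L w t))%:E)%E \is a fin_num) ->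
  (\int[P]_w (g (L w (s m (K m w))))%:E =
   \int[P]_w (\int[P]_w' g (L w' (s m (K m w))))%:E)%E.
Proof.
move=> mg g0 gfin.
rewrite (@integral_split m (fun w => (g (L w (s m (K m w))))%:E)); last 2 first.
- apply/measurable_EFinP.
  apply: (@measurable_discrete _ _ m (fun k w => g (L w (s m k)))) => k.
  by apply: measurableT_comp => //; exact: mL.
- by move=> w; rewrite lee_fin.
rewrite (@integral_split m
    (fun w => (\int[P]_w' g (L w' (s m (K m w))))%:E)); last 2 first.
- apply/measurable_EFinP.
  apply: (@measurable_discrete _ _ m
    (fun k _ => \int[P]_w' g (L w' (s m k)))) => k.
  exact: measurable_cst.
- by move=> w; rewrite lee_fin; apply: Rintegral_ge0.
apply: eq_eseriesr => k _.
transitivity (\int[P]_(w in K m @^-1` [set k]) (g (L w (s m k)))%:E)%E.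
  by apply: eq_integral => w; rewrite inE/= => ->.
transitivity (\int[P]_(w in K m @^-1` [set k]) (\int[P]_w' g (L w' (s m k)))%:E)%E;
  last by apply: eq_integral => w; rewrite inE/= => ->.
rewrite integral_cst// muleC.
rewrite (@ge0_integral_indep (fun w => L w (s m k)) _ (fun x => (g x)%:E))//.
- congr (_ * _)%E; rewrite /Rintegral fineK//; exact: gfin.
- exact: mL.
- exact/measurable_EFinP.
- move=> B mB; case: k => [|k].
    (* [K m] is a successor, so the event for index 0 is empty. *)
    rewrite (_ : K m @^-1` _ = set0) ?setI0 ?measure0 ?mule0//.
    by apply/seteqP; split.
  rewrite preimage_K; apply: tau_indep; last exact: measurable_itv.
  by apply: sub_sigma_algebra; exists (s m k.+1), B.
Qed.

(** Conditioning on [tau]. The discretised identity passes to the limit by right continuity of paths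
    on the left and of [mean_lim] on the right. *)
Lemma Rintegral_levy_random_time (h : \bar R -> R) (M : R) :
  continuous h -> (forall y, 0 <= h y <= M) ->
  \int[P]_w h (L w (tau w))%:E = \int[P]_w mean_lim P L h (tau w).
Proof.
move=> ch h0.
have hM y : `|h y| <= M by have /andP[? ?] := h0 y; rewrite ger0_norm.
have mhE : measurable_fun setT (h \o EFin).
  by apply: continuous_measurable_fun => x; exact: (ch x%:E).
have lhs : (\int[P]_w (h (L w (s m (K m w)))%:E)%:E)%E @[m --> \oo] -->
    (\int[P]_w (h (L w (tau w))%:E)%:E)%E.
  apply: (dominated_cvg measurableT _ _ _ (integrable_cstT P M)) => //.
  - move=> m; apply/measurable_EFinP.
    apply: (@measurable_discrete _ _ m (fun k w => h (L w (s m k))%:E)) => k.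
    by apply: (measurableT_comp mhE); exact: mL.
  - move=> w _; apply: cvg_EFin; first exact: nearW.
    by move=> A /(ch (L w (tau w))%:E); exact: L_cvg.
  - by move=> m w _; rewrite lee_fin hM.
have rhs : (\int[P]_w (mean_lim P L h (s m (K m w)))%:E)%E @[m --> \oo] -->
    (\int[P]_w (mean_lim P L h (tau w))%:E)%E.
  apply: (dominated_cvg measurableT _ _ _ (integrable_cstT P M)) => //.
  - move=> m; apply/measurable_EFinP.
    apply: (@measurable_discrete _ _ m (fun k _ => mean_lim P L h (s m k))) => k.
    exact: measurable_cst.
  - move=> w _; apply: cvg_EFin; first exact: nearW.
    exact: (mean_lim_cvg ch h0).
  - move=> m w _; have /andP[? ?] := mean_lim_bounds ch h0 (s0 m (K m w)).
    by rewrite lee_fin ger0_norm.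
rewrite /Rintegral; congr fine; apply: (cvg_unique _ _ rhs) => //.
apply: cvg_trans lhs; apply: near_eq_cvg; near=> m.
rewrite (@ge0_integral_discrete (h \o EFin))//.
- by move=> x; case/andP: (h0 x%:E).
- move=> t t0; apply: integrable_fin_num => //.
  exact: (integrable_test_process P ch hM (mLE t0)).
Unshelve. all: by end_near. Qed.

Hypothesis L_exp : forall t, 0 <= t -> ('E_P[fun w => expR (L w t)] = 1)%E.

(** The exponential is unbounded, so conditioning is applied to [min(exp, n)]. Its means at fixed
    times tend to 1 and stay below 1, so dominated convergence handles the average over [tau], and
    monotone convergence the other side. *)
Lemma expectation_exp_levy_random_time :
  ('E_P[fun w => expR (L w (tau w))] = 1)%E.
Proof.
have min_cvg (x : R) : (min_exp n%:R x%:E)%:E @[n --> \oo] --> (expR x)%:E.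
  apply: cvg_EFin; first exact: nearW.
  apply: cvg_near_cst; near=> n; rewrite /= min_exp_EFin; apply/min_idPl.
  by near: n; exact: nbhs_infty_ger.
have min0 n (x : R) : 0 <= min_exp n%:R x%:E.
  by case/andP: (@min_exp_bounds R n%:R x%:E (ler0n _ _)).
have min_nd (x : R) : nondecreasing_seq (fun n => (min_exp n%:R x%:E)%:E).
  move=> m n mn; rewrite lee_fin !min_exp_EFin le_min ge_min lexx/=.
  by rewrite ge_min ler_nat mn orbT.
have mmin n : measurable_fun setT (fun x : R => min_exp n%:R x%:E).
  apply: continuous_measurable_fun => x.
  exact: (@continuous_min_exp R n%:R (ler0n _ _) x%:E).
have cvg_min (X : Om -> R) : measurable_fun setT X ->
    (\int[P]_w (min_exp n%:R (X w)%:E)%:E)%E @[n --> \oo] -->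
    (\int[P]_w (expR (X w))%:E)%E.
  move=> mX.
  have := @cvg_monotone_convergence _ _ _ P setT measurableT
    (fun n w => (min_exp n%:R (X w)%:E)%:E).
  rewrite (_ : (fun x => limn _) = fun w => (expR (X w))%:E); last first.
    by apply/funext => w; apply/cvg_lim => //; exact: min_cvg.
  apply=> [n|n w _|w _ m n mn].
  - by apply/measurable_EFinP; exact: (measurableT_comp (mmin n)).
  - by rewrite lee_fin.
  - exact: min_nd.
have ch n := @continuous_min_exp R n%:R (ler0n _ _).
have hb n y := @min_exp_bounds R n%:R y (ler0n _ _).
have hM n y : `|min_exp n%:R y| <= n%:R :> R.
  by have /andP[? ?] := hb n y; rewrite ger0_norm.
have mlE n t : 0 <= t -> (mean_lim P L (min_exp n%:R) t)%:E =
    (\int[P]_w (min_exp n%:R (L w t)%:E)%:E)%E.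
  move=> t0; rewrite integral_EFin_Rintegral//.
  exact: (integrable_test_process P (ch n) (hM n) (mLE t0)).
have ml_cvg t : 0 <= t ->
    (mean_lim P L (min_exp n%:R) t)%:E @[n --> \oo] --> 1%E.
  move=> t0; under eq_cvg do rewrite mlE//.
  have := cvg_min _ (mL t0); have := L_exp t0.
  by rewrite unlock => ->.
have ml1 n t : 0 <= t -> 0 <= mean_lim P L (min_exp n%:R) t <= 1.
  move=> t0; have /andP[-> _] := mean_lim_bounds (ch n) (hb n) t0.
  rewrite -lee_fin mlE//; have := L_exp t0; rewrite unlock => <-.
  apply: ge0_le_integral => //.
  - by move=> w _; rewrite lee_fin.
  - by apply/measurable_EFinP; apply: (measurableT_comp (mmin n)); exact: mL.
  - by apply/measurable_EFinP; apply: measurableT_comp => //; exact: mL.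
  - by move=> w _; rewrite lee_fin min_exp_EFin ge_min lexx.
have mml n : measurable_fun setT (fun w => mean_lim P L (min_exp n%:R) (tau w)).
  apply: (@measurable_fun_cvg _ _ _ _
    (fun m w => mean_lim P L (min_exp n%:R) (s m (K m w)))) => [m|w _].
    apply: (@measurable_discrete _ _ m
      (fun k _ => mean_lim P L (min_exp n%:R) (s m k))) => k.
    exact: measurable_cst.
  exact: (mean_lim_cvg (ch n) (hb n)).
rewrite unlock; apply: (cvg_unique _ (cvg_min _ measurable_levy_random_time)) => //.
have -> : 1%E = (\int[P]_w (cst 1%E w))%E :> \bar R.
  by rewrite integral_cst// mul1e; apply/esym; exact: probability_setT.
apply: (@cvg_trans _ ((\int[P]_w (mean_lim P L (min_exp n%:R) (tau w))%:E)%E @[n --> \oo])).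
  apply: near_eq_cvg; near=> n.
  rewrite integral_EFin_Rintegral; last first.
    apply: (@bounded_integrable _ _ _ P _ 1) => // w.
    by have /andP[? ?] := ml1 n (tau w) (tau_ge0 w); rewrite ger0_norm.
  rewrite integral_EFin_Rintegral.
    by rewrite -(Rintegral_levy_random_time (ch n) (hb n)).
  apply: (integrable_test_process P (ch n) (hM n)).
  by apply/measurable_EFinP; exact: measurable_levy_random_time.
apply: (dominated_cvg measurableT _ _ _ (integrable_cstT P 1)) => //.
- by move=> n; apply/measurable_EFinP.
- by move=> w _; exact: ml_cvg.
- move=> n w _; have /andP[? ?] := ml1 n (tau w) (tau_ge0 w).
  by rewrite lee_fin ger0_norm.
Unshelve. all: by end_near. Qed.

End random_time.

(** * Convergence in law at random times *)

Section random_index_convergence.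
Context (R : realType) d (Om : measurableType d) (P : probability Om R).
Variable L : Om -> skorokhod R R.
Hypothesis L_levy : is_levy P L.
Context d1 (Om1 : measurableType d1) (P1 : probability Om1 R).
Variable G : nat -> Om1 -> skorokhod R (\bar R).
Hypothesis mG : \forall n \near \oo, forall s, 0 <= s ->
  measurable_fun setT (fun x => G n x s).
Hypothesis G_cvg : cvg_in_law P1 G P (fun w => EFin_path (L w)).
Context d' (Om' : measurableType d') (P' : probability Om' R).
Variable N : nat -> {RV P' >-> nat}.
Variables (tau : {RV P >-> R}) (tau_ge0 : forall w, 0 <= tau w).
Hypothesis tau_indep : indep_process P L tau.
Hypothesis N_cvg : cvg_in_law P' (fun n w => (N n w)%:R / n%:R : R) P tau.

Let T (n : nat) (w : Om') : R := (N n w)%:R / n%:R.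

Let T0 n w : 0 <= T n w. Proof. by rewrite divr_ge0. Qed.

(** Any [g] is allowed because [N n] takes values in the discrete space [nat]. *)
Let measurable_T n (g : R -> R) : measurable_fun setT (g \o T n).
Proof.
apply: (@measurableT_comp _ _ _ _ _ _ (fun k : nat => g (k%:R / n%:R)) _ (N n)) => //.
Qed.

Let mean_at_bounds (h : \bar R -> R) M n t : (forall y, 0 <= h y <= M) ->
  continuous h -> measurable_fun setT (fun x => G n x t) ->
  0 <= mean_at P1 G h n t <= M.
Proof.
move=> h0 ch mGt.
have hM y : `|h y| <= M by have /andP[? ?] := h0 y; rewrite ger0_norm.
rewrite Rintegral_ge0/=; last by move=> x _; case/andP: (h0 (G n x t)).
rewrite -[leRHS](Rintegral_cstT P1); apply: le_Rintegral => //.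
- exact: (integrable_test_process P1 ch hM mGt).
- exact: integrable_cstT.
- by move=> x _; case/andP: (h0 (G n x t)).
Qed.

Let mean_lim_cvg_random (h : \bar R -> R) (M : R) :
  continuous h -> (forall y, 0 <= h y <= M) ->
  \int[P']_w mean_lim P L h (T n w) @[n --> \oo] -->
  \int[P]_w mean_lim P L h (tau w).
Proof.
move=> ch h0.
have hM y : `|h y| <= M by have /andP[? ?] := h0 y; rewrite ger0_norm.
(* [N_cvg] tests against functions on all of [R]; composing with the norm extends [mean_lim]
   continuously below 0. *)
pose psi (t : R) := mean_lim P L h `|t|.
have psi_bounds t : 0 <= psi t <= M by exact: (mean_lim_bounds L_levy ch h0).
have psiM t : `|psi t| <= M by have /andP[? ?] := psi_bounds t; rewrite ger0_norm.
have cpsi : continuous psi.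
  move=> t; apply/cvgrPdist_le => e e0.
  have [r r0 rP] := mean_lim_continuous L_levy mG G_cvg ch hM (normr_ge0 t) e0.
  near=> t'; rewrite distrC; apply: rP => //.
  apply: le_trans (ler_dist_dist _ _) _; near: t'.
  exact: (@cvgr_distC_le _ _ _ _ _ id).
have psiE d2 (T2 : measurableType d2) (P2 : probability T2 R) (X : T2 -> R) :
    (forall w, 0 <= X w) -> measurable_fun setT (psi \o X) ->
    ('E_P2[psi \o X])%E = (\int[P2]_w mean_lim P L h (X w))%:E.
  move=> X0 mX; rewrite unlock integral_EFin_Rintegral.
    by congr EFin; apply: eq_Rintegral => w _; rewrite /psi /= ger0_norm.
  by apply: (@bounded_integrable _ _ _ P2 _ M) => // w; exact: psiM.
have := N_cvg cpsi (ex_intro _ M psiM).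
rewrite psiE//; last first.
  by apply: measurableT_comp => //; exact: continuous_measurable_fun.
move=> cvgE.
have -> : (fun n => \int[P']_w mean_lim P L h (T n w)) =
    (fun n => fine ('E_P'[psi \o T n])%E).
  by apply/funext => n; rewrite psiE// ; exact: (measurable_T n psi).
exact: fine_cvg.
Unshelve. all: by end_near. Qed.

(** Uniform convergence controls times up to [K.+1]; later times carry little mass for [tau], hence
    for [N_n / n] eventually. *)
Let mean_gap_cvg (h : \bar R -> R) (M : R) :
  continuous h -> (forall y, 0 <= h y <= M) ->
  (\int[P']_w mean_at P1 G h n (T n w) - \int[P']_w mean_lim P L h (T n w))
    @[n --> \oo] --> (0 : R).
Proof.
move=> ch h0.
have hM y : `|h y| <= M by have /andP[? ?] := h0 y; rewrite ger0_norm.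
have M0 : 0 <= M by have /andP[/le_trans] := h0 0%E; apply.
(* A continuous ramp from 0 at [K] to 1 at [K + 1]: an admissible test for [N_cvg] that dominates
   the indicator of the tail. *)
pose kappa (K : nat) (t : R) := Num.max 0 (Num.min 1 (t - K%:R)).
have kappa01 K t : 0 <= kappa K t <= 1.
  by rewrite /kappa le_max lexx/= ge_max ler01/= ge_min lexx.
have kappaM K t : `|kappa K t| <= 1.
  by have /andP[? ?] := kappa01 K t; rewrite ger0_norm.
have ckappa K : continuous (kappa K).
  rewrite /kappa => t.
  apply: (@continuous_max _ _ (cst 0 : R -> R)
    (fun t : R => Num.min 1 (t - K%:R))); first exact: cst_continuous.
  apply: (@continuous_min _ _ (cst 1 : R -> R)
    (fun t : R => t - K%:R)); first exact: cst_continuous.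
  by apply: cvgB; [exact: cvg_id|exact: cvg_cst].
have mkappa K : measurable_fun setT (kappa K) by exact: continuous_measurable_fun.
have kappa_tau : (\int[P]_w (kappa K (tau w))%:E)%E @[K --> \oo] --> 0%E.
  suff : (\int[P]_w (kappa K (tau w))%:E)%E @[K --> \oo] -->
      (\int[P]_w (cst 0%E w))%E by rewrite integral0.
  apply: (dominated_cvg measurableT _ _ _ (integrable_cstT P 1)) => //.
  - by move=> K; apply/measurable_EFinP; exact: measurableT_comp.
  - move=> w _; apply: cvg_EFin; first exact: nearW.
    apply: cvg_near_cst; apply: filterS (nbhs_infty_ger (tau w)) => K tK.
    by rewrite /= /kappa; apply/max_idPl; rewrite ge_min subr_le0 tK orbT.
  - by move=> K w _; rewrite lee_fin.
apply/cvgrPdist_le => e e0.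
have M10 : 0 < 2 * (M + 1) by lra.
(* [2 * (M + 1)] bounds the gap on the tail, which may cost [e / 2]. The further half leaves room
   for passing from [tau] to [N_n / n]. *)
have c0 : 0 < e / 2 / (2 * (M + 1)) by rewrite !divr_gt0.
have c20 : 0 < e / 2 / (2 * (M + 1)) / 2 by rewrite divr_gt0.
have ik_tau K : P.-integrable setT (EFin \o (fun w => kappa K (tau w))).
  apply: (@bounded_integrable _ _ _ P _ 1) => [|w]; last exact: kappaM.
  exact: measurableT_comp.
have [K Ksmall] : exists K, \int[P]_w kappa K (tau w) <= e / 2 / (2 * (M + 1)) / 2.
  have /fine_cvg/cvgrPdist_le/(_ _ c20)[K _ /(_ K (leqnn K))] := kappa_tau.
  rewrite sub0r normrN => /(le_trans (ler_norm _)) ?.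
  by exists K.
have e20 : 0 < e / 2 by rewrite divr_gt0.
have unif := mean_at_cvg_unif L_levy mG G_cvg (K.+1%:R) ch hM e20.
have Ksmall' : \forall n \near \oo,
    \int[P']_w kappa K (T n w) <= e / 2 / (2 * (M + 1)).
  have := N_cvg (ckappa K) (ex_intro _ 1 (kappaM K)).
  rewrite unlock (integral_EFin_Rintegral (ik_tau K)).
  move=> /fine_cvg/cvgrPdist_le/(_ _ c20); apply: filterS => n.
  rewrite ler_norml => /andP[h1 _].
  have : - (e / 2 / (2 * (M + 1)) / 2) <=
    \int[P]_w kappa K (tau w) - \int[P']_w kappa K (T n w) by [].
  by lra.
near=> n.
have mGn : forall s, 0 <= s -> measurable_fun setT (fun x => G n x s) by near: n.
have un : forall s, 0 <= s <= K.+1%:R ->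
  `|mean_at P1 G h n s - mean_lim P L h s| <= e / 2 by near: n.
have i1 : P'.-integrable setT (EFin \o (fun w => mean_at P1 G h n (T n w))).
  apply: (@bounded_integrable _ _ _ P' _ M) => [|w].
    exact: (measurable_T n (mean_at P1 G h n)).
  have /andP[? ?] := mean_at_bounds h0 ch (mGn _ (T0 n w)).
  by rewrite ger0_norm.
have i2 : P'.-integrable setT (EFin \o (fun w => mean_lim P L h (T n w))).
  apply: (@bounded_integrable _ _ _ P' _ M) => [|w].
    exact: (measurable_T n (mean_lim P L h)).
  have /andP[? ?] := mean_lim_bounds L_levy ch h0 (T0 n w).
  by rewrite ger0_norm.
have ik : P'.-integrable setT (EFin \o (fun w => kappa K (T n w))).
  apply: (@bounded_integrable _ _ _ P' _ 1) => [|w]; last exact: kappaM.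
  exact: (measurable_T n (kappa K)).
rewrite sub0r normrN -RintegralB//.
apply: le_trans (le_normr_Rintegral _ _) _ => //; first exact: integrable_sub.
apply: (@le_trans _ _ (\int[P']_w (e / 2 + 2 * (M + 1) * kappa K (T n w)))).
  apply: le_Rintegral => //.
  - by apply: integrable_norm => //; exact: integrable_sub.
  - by apply: integrable_add; [exact: integrable_cstT|exact: integrable_scale].
  move=> w _; have /andP[k0 k1] := kappa01 K (T n w).
  have [small|big] := leP (T n w) K.+1%:R.
    have := un (T n w); rewrite T0 small => /(_ isT) /le_trans; apply.
    by rewrite lerDl mulr_ge0// ltW.
  have -> : kappa K (T n w) = 1.
    rewrite /kappa (_ : Num.min _ _ = 1); first by apply/max_idPr.
    by apply/min_idPl; rewrite lerBrDl natr1 ltW.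
  have /andP[? ?] := mean_at_bounds h0 ch (mGn _ (T0 n w)).
  have /andP[? ?] := mean_lim_bounds L_levy ch h0 (T0 n w).
  by rewrite mulr1 ler_norml; apply/andP; split; lra.
rewrite Rintegral_cstD; last exact: integrable_scale.
rewrite RintegralZl//.
have : \int[P']_w kappa K (T n w) <= e / 2 / (2 * (M + 1)) by near: n.
rewrite ler_pdivlMr// mulrC; lra.
Unshelve. all: by end_near. Qed.

Let Rintegral_random_index (h : \bar R -> R) (M : R) n :
  continuous h -> (forall y, 0 <= h y <= M) ->
  (forall s, 0 <= s -> measurable_fun setT (fun x => G n x s)) ->
  (\int[product_probability P' P1]_z (h (G n z.2 (T n z.1)))%:E =
   (\int[P']_w mean_at P1 G h n (T n w))%:E)%E.
Proof.
move=> ch h0 mGn.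
have hM y : `|h y| <= M by have /andP[? ?] := h0 y; rewrite ger0_norm.
have mh : measurable_fun setT (fun z : Om' * Om1 => (h (G n z.2 (T n z.1)))%:E).
  apply/measurable_EFinP.
  apply: (@measurable_nat_index _ _ _ _ _ _ (N n)
    (fun k x => h (G n x (k%:R / n%:R)))) => // k.
  apply: (measurableT_comp (ereal_continuous_measurable ch)).
  by apply: mGn; rewrite divr_ge0.
have hz0 (z : Om' * Om1) : (0 <= (h (G n z.2 (T n z.1)))%:E)%E.
  by rewrite lee_fin; case/andP: (h0 (G n z.2 (T n z.1))).
transitivity (\int[P']_w \int[P1]_x (h (G n x (T n w)))%:E)%E.
  exact: (@fubini_tonelli1 _ _ _ _ _ P' P1 _ mh hz0).
rewrite -integral_EFin_Rintegral; last first.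
  apply: (@bounded_integrable _ _ _ P' _ M) => [|w].
    exact: (measurable_T n (mean_at P1 G h n)).
  have /andP[? ?] := mean_at_bounds h0 ch (mGn _ (T0 n w)).
  by rewrite ger0_norm.
apply: eq_integral => w _; rewrite integral_EFin_Rintegral//.
exact: (integrable_test_process P1 ch hM (mGn _ (T0 n w))).
Qed.

Lemma cvg_in_law_random_index :
  cvg_in_law (product_probability P' P1) (fun n z => G n z.2 (T n z.1))
    P (fun w => (L w (tau w))%:E).
Proof.
move=> h ch [M hM].
(* Shifted to be nonnegative, as the preceding lemmas require; [M] is subtracted again at the
   end. *)
pose g y := M + h y.
have g0 y : 0 <= g y <= 2 * M.
  by have := hM y; rewrite ler_norml => /andP[? ?]; apply/andP; split; rewrite /g; lra.
have cg : continuous g by move=> y; apply: cvgD; [exact: cvg_cst|exact: ch].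
have cvg_g : \int[P']_w mean_at P1 G g n (T n w) @[n --> \oo] -->
    \int[P]_w g (L w (tau w))%:E.
  rewrite (Rintegral_levy_random_time L_levy tau_ge0 tau_indep cg g0).
  have -> : (fun n => \int[P']_w mean_at P1 G g n (T n w)) = (fun n =>
      (\int[P']_w mean_at P1 G g n (T n w) - \int[P']_w mean_lim P L g (T n w)) +
      \int[P']_w mean_lim P L g (T n w)).
    by apply/funext => n; rewrite subrK.
  rewrite -[X in _ --> X]add0r.
  exact: cvgD (mean_gap_cvg cg g0) (mean_lim_cvg_random cg g0).
have mLt : measurable_fun setT (fun w => (L w (tau w))%:E).
  by apply/measurable_EFinP; exact: (measurable_levy_random_time L_levy tau_ge0).
have EL : ('E_P[h \o (fun w => (L w (tau w))%:E)])%E =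
    (\int[P]_w g (L w (tau w))%:E - M)%:E.
  have ih := integrable_test_process P ch hM mLt.
  rewrite unlock integral_EFin_Rintegral// /g Rintegral_cstD//.
  by rewrite addrC addKr.
rewrite EL.
apply: (@cvg_trans _ ((\int[P']_w mean_at P1 G g n (T n w) - M)%:E @[n --> \oo])).
  apply: near_eq_cvg; near=> n.
  have mGn : forall s, 0 <= s -> measurable_fun setT (fun x => G n x s) by near: n.
  have mz : measurable_fun setT (fun z : Om' * Om1 => G n z.2 (T n z.1)).
    apply: (@measurable_nat_index _ _ _ _ _ _ (N n)
      (fun k x => G n x (k%:R / n%:R))) => // k.
    by apply: mGn; rewrite divr_ge0.
  have ih := integrable_test_process (product_probability P' P1) ch hM mz.
  have := Rintegral_random_index cg g0 mGn.
  rewrite integral_EFin_Rintegral; last first.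
    exact: (integrable_add (integrable_cstT _ M) ih).
  move=> [<-]; rewrite unlock integral_EFin_Rintegral//; congr EFin.
  by rewrite Rintegral_cstD// addrC addKr.
apply: cvg_EFin; first exact: nearW.
by apply: cvgB; [exact: cvg_g|exact: cvg_cst].
Unshelve. all: by end_near. Qed.

End random_index_convergence.

(** * The limit of experiments with a random number of repetitions *)

Lemma random_power_lr_sample (R : realType) (f : R -> R) d (Om : measurableType d)
    (P : probability Om R) (N : {RV P >-> nat})
    (z : Om * seq_space (measurableTypeR R)) (c : R) :
  Num.min (random_power_lr (canonical_lr f) (random_sample N z)) c =
  min_exp c (log_lr f (N z.1) z.2).
Proof.
rewrite min_exp_log_lr /random_power_lr /=; congr (Num.min _ _).
by apply: eq_bigr => i _; rewrite tnth_mktuple.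
Qed.

Theorem mainTheorem6 (R : realType)
  (f : nat -> R -> R) (Q : nat -> probability (measurableTypeR R) R)
  (f_tradeoff : forall n, (0 < n)%N -> is_tradeoff (f n))
  (f0 : forall n, (0 < n)%N -> f n 0 = 1)
  (fQ : forall n, (0 < n)%N -> canonical_rep (f n) (Q n))
  (Uinf : probability (seq_space (measurableTypeR R)) R)
  (UinfE : is_countable_power (@unif R) Uinf)
  (d : measure_display) (Om : measurableType d) (P : probability Om R)
  (L : Om -> skorokhod R R) (L_levy : is_levy P L)
  (L_exp : forall t, 0 <= t -> ('E_P[fun w => expR (L w t)] = 1)%E)
  (g_cvg : cvg_in_law Uinf (fun n x => log_lr_path (f n) n x)
             P (fun w => EFin_path (L w)))
  (d' : measure_display) (Om' : measurableType d') (P' : probability Om' R)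
  (N : nat -> {RV P' >-> nat})
  (tau : {RV P >-> R}) (tau_ge0 : forall w, 0 <= tau w)
  (tau_indep : indep_process P L tau)
  (N_cvg : cvg_in_law P' (fun n w => (N n w)%:R / n%:R : R) P tau) :
  [/\ forall n w x, (0 < n)%N ->
        log_lr_path (f n) n x ((N n w)%:R / n%:R) = log_lr (f n) (N n w) x,
      cvg_in_law (product_probability P' Uinf)
        (fun n z => log_lr (f n) (N n z.1) z.2)
        P (fun w => (L w (tau w))%:E),
      ('E_P[fun w => expR (L w (tau w))] = 1)%E &
      exists Pinf Qinf : probability (measurableTypeR R) R,
        [/\ is_law P (fun w => L w (tau w)) Pinf,
            forall A, measurable A ->
              Qinf A = (\int[Pinf]_(x in A) (expR x)%:E)%E &
            forall alpha, 0 <= alpha <= 1 ->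
              tradeoff (random_power (distribution P' (N n)) unif)
                       (random_power (distribution P' (N n)) (Q n)) alpha
                @[n --> \oo] --> tradeoff Pinf Qinf alpha]].
Proof.
have mX := measurable_levy_random_time L_levy tau_ge0.
pose X : {mfun Om >-> measurableTypeR R} :=
  HB.pack_for {mfun Om >-> measurableTypeR R} (fun w => L w (tau w) : R)
    (isMeasurableFun.Build _ _ _ _ (fun w => L w (tau w) : measurableTypeR R) mX).
have dens n : (0 < n)%N -> has_density (@unif R) (Q n) (canonical_lr (f n)).
  by move=> n0; exact: (has_density_canonical (f_tradeoff n n0) (f0 n n0) (fQ n n0)).
have pathE n w x : (0 < n)%N ->
    log_lr_path (f n) n x ((N n w)%:R / n%:R) = log_lr (f n) (N n w) x.
  move=> n0; rewrite /log_lr_path /step_path /=; congr log_lr.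
  by rewrite divfK ?pnatr_eq0 -?lt0n// natrK.
(* Measurability comes from the trade-off hypotheses on [f n], which start at [n = 1]. *)
have mG : \forall n \near \oo, forall s, 0 <= s ->
    measurable_fun setT (fun x => log_lr_path (f n) n x s).
  exists 1%N => // n /= n0 s _; apply: measurable_log_lr.
  by have [] := dens n n0.
have cvgX : cvg_in_law (product_probability P' Uinf)
    (fun n z => log_lr (f n) (N n z.1) z.2) P (fun w => (L w (tau w))%:E).
  move=> h ch hM.
  have := cvg_in_law_random_index L_levy mG g_cvg tau_ge0 tau_indep N_cvg ch hM.
  apply: cvg_trans; apply: near_eq_cvg; exists 1%N => // n /= n0.
  congr ('E_ _ [_])%E; apply/funext => z; rewrite /comp.
  by congr (h _); exact: pathE.
have EX := expectation_exp_levy_random_time L_levy tau_ge0 tau_indep L_exp.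
have intX (g : R -> \bar R) : measurable_fun setT g -> (forall x, 0 <= g x)%E ->
    (\int[distribution P X]_x g x = \int[P]_w g (L w (tau w)))%E.
  by move=> mg g0; rewrite ge0_integral_pushforward.
have mexp : measurable_fun [set: measurableTypeR R] (@expR R) by exact: measurable_expR.
have exp0 (x : R) : 0 <= expR x by exact: expR_ge0.
have exp1 : (\int[distribution P X]_x (expR x)%:E = 1)%E.
  rewrite intX//; first by move: EX; rewrite unlock.
  exact/measurable_EFinP.
pose Qinf := @density_probability _ (measurableTypeR R) R (distribution P X)
  (@expR R) mexp exp0 exp1.
split=> //.
exists (distribution P X), Qinf; split=> // alpha /andP[alpha0 _].
have dn : \forall n \near \oo, has_density
    (random_power (distribution P' (N n)) unif)
    (random_power (distribution P' (N n)) (Q n))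
    (random_power_lr (canonical_lr (f n))).
  by exists 1%N => // n /= n0; exact: (has_density_random_power _ (dens n n0)).
have dlim : has_density (distribution P X) Qinf (@expR R) by split.
apply: (cvg_tradeoff dn dlim _ alpha0) => c c0.
have hb y := @min_exp_bounds R c y c0.
have hM y : `|min_exp c y| <= c by have /andP[? ?] := hb y; rewrite ger0_norm.
have mmin : measurable_fun setT (fun x : R => Num.min (expR x) c).
  exact: measurable_minr.
have min0 (x : R) : 0 <= Num.min (expR x) c by rewrite le_min exp0.
have EP : ('E_P[min_exp c \o (fun w => (L w (tau w))%:E)] =
    (\int[distribution P X]_x Num.min (expR x) c)%:E)%E.
  rewrite -integral_EFin_Rintegral; last first.
    apply: (@bounded_integrable _ _ _ _ _ c) => // x.
    by rewrite ger0_norm// ge_min lexx orbT.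
  rewrite intX//; last exact/measurable_EFinP.
  by rewrite unlock; apply: eq_integral => w _; rewrite /= min_exp_EFin.
(* Truncated likelihood ratios are bounded continuous functions of the log-likelihood ratio, so
   convergence in law gives exactly what duality asks for. *)
have := cvgX _ (continuous_min_exp c0) (ex_intro _ c hM).
rewrite EP => /fine_cvg; apply: cvg_trans; apply: near_eq_cvg.
exists 1%N => // n /= n0.
have [mz z0 _] := has_density_random_power (distribution P' (N n)) (dens n n0).
rewrite unlock /= /Rintegral; congr fine.
rewrite (ge0_integral_random_sample (N n) UinfE)//; last 2 first.
- by apply/measurable_EFinP; exact: measurable_minr.
- by move=> x; rewrite lee_fin le_min z0.
by apply: eq_integral => z _; rewrite random_power_lr_sample.
Qed.
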